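(* Let $0<\delta<1$ and suppose that, as $n\to\infty$, $q(n)\sim c_q\,L(n)\,n^{-3/2}$ for some constant $c_q>0$, and that $L'(n):=\sqrt n\,P(n)$ is slowly varying at infinity. Then, as $N\to\infty$, $$\widetilde Z^{\mathrm c}_{\delta,N}\ \sim\ \frac{\delta\,c_q}{(1-\delta)^2}\;\frac{L(N)}{N^{3/2}},\qquad\qquad \widetilde Z^{\mathrm f}_{\delta,N}\ \sim\ \frac{1}{1-\delta}\;\frac{L'(N)}{N^{1/2}}.$$
   Context: For positive sequences, $a_n\sim b_n$ means $a_n/b_n\to1$. $\mathbb R^+=[0,\infty)$, $\mathbb N=\{1,2,\dots\}$. Model. $\mu$ is either Lebesgue measure on $\mathbb R$ (continuous set-up) or counting measure on $\mathbb Z$ (discrete set-up). $V:\mathbb R\to\mathbb R\cup\{+\infty\}$ satisfies $V(0)<\infty$ and $\kappa:=\int_{\mathbb R}e^{-V(y)}\mu(dy)<\infty$; in the continuous set-up $\exp(-V(\cdot))$ is continuous. Let $(Y_i)_{i\in\mathbb N}$ be IID with law $\mathbf P(Y_1\in dx)=\kappa^{-1}e^{-V(x)}\mu(dx)$, and $S_0=0$, $S_n=Y_1+\dots+Y_n$. Standing assumption (H): $\mathbf E[Y_1]=0$ and the truncated variance $\mathcal V(t):=\mathbf E[|Y_1|^2\mathbf 1_{\{|Y_1|\le t\}}]$ is slowly varying at infinity (a function $\ell$ is slowly varying if $\ell(ct)/\ell(t)\to1$ as $t\to\infty$ for each $c>0$). Partition functions. For $\varepsilon\ge0$, $N\in\mathbb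 N$, $a\in\{\mathrm f,\mathrm c\}$, $$Z^a_{\varepsilon,N}:=\int_{(\mathbb R^+)^N}e^{-H^a_N(x)}\prod_{i=1}^N\big(\mathbf 1_{(x_i>0)}\mu(dx_i)+\varepsilon\,\delta_0(dx_i)\big),$$ with $\delta_0$ the Dirac mass at $0$, $H^{\mathrm f}_N(x)=\sum_{i=0}^{N-1}V(x_{i+1}-x_i)$ with $x_0=0$, and $H^{\mathrm c}_N(x)=\sum_{i=0}^{N}V(x_{i+1}-x_i)$ with $x_0=x_{N+1}=0$. Set $Z^{\mathrm c}_{\varepsilon,0}:=e^{-V(0)}$. Let $L(\cdot)$ be the slowly varying function satisfying $L(x)\sim 1/\sqrt{\mathcal V(\sqrt x/L(x))}$ as $x\to\infty$ (explicitly $L(x)=\sqrt x/g^{-1}(x)$ with $g$ increasing and $g(x)\sim x^2/\mathcal V(x)$), so that $L(n)S_n/\sqrt n$ converges in law to a standard Gaussian. Define $\gamma:=\sum_{n\ge1}Z^{\mathrm c}_{0,n-1}/\kappa^n$, which is finite, and the probability distribution $q(n):=\gamma^{-1}Z^{\mathrm c}_{0,n-1}/\kappa^n$, $n\ge1$. Put $P(n):=\mathbf P(S_i>0,\ i=1,\dots,n)$, $P(0):=1$. Modified partition functions. For $\delta\geq 0$ and $N\ge1$, with $\varepsilon=\delta/\gamma$, $$\widetilde Z^{\mathrm c}_{\delta,N}:=\frac{(\delta/\gamma)\,Z^{\mathrm c}_{\delta/\gamma,N-1}}{\kappa^N},\qquad \widetilde Z^{\mathrm c}_{\delta,0}:=1,\qquad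 \widetilde Z^{\mathrm f}_{\delta,N}:=\frac{Z^{\mathrm f}_{\delta/\gamma,N}}{\kappa^N}.$$ *)

(* Defs.v *)
From HB Require Import structures.
From mathcomp Require Import all_boot all_order all_algebra.
From mathcomp Require Import all_classical all_reals all_analysis.
Set Implicit Arguments.
Unset Strict Implicit.
Unset Printing Implicit Defensive.
Import Order.TTheory GRing.Theory Num.Theory numFieldNormedType.Exports.
Local Open Scope classical_set_scope.
Local Open Scope ring_scope.

Section asymptotics.
Context {R : realType}.

Definition asymp_equiv {T : Type} (F : set_system T) (a b : T -> R) : Prop :=
  a t / b t @[t --> F] --> (1 : R).

(* Positivity and measurability near infinity are part of Karamata's
   definition of slow variation. *)
Definition slowly_varying (l : R -> R) : Prop :=
  (exists X : R,
      measurable_fun `[X, +oo[ l /\ (forall t, X <= t -> 0 < l t)) /\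
  forall c : R, 0 < c -> asymp_equiv +oo (fun t => l (c * t)) l.

Definition slowly_varying_seq (u : nat -> R) : Prop :=
  slowly_varying (fun x => u (Num.truncn x)).

End asymptotics.

Section reference_measure.
Context {R : realType}.

Lemma measurable_range_intr :
  measurable (range (fun z : int => z%:~R : measurableTypeR R)).
Proof.
apply: countable_measurable; first by move=> t; exact: measurable_set1.
exact: (sub_countable (card_image_le _ _) (countableP _)).
Qed.

Inductive setup := ContinuousSetup | DiscreteSetup.

(* The counting measure of Z is viewed as a measure on the line, so that both
   set-ups share the same state space. *)
Definition refmeas (s : setup) : {measure set (measurableTypeR R) -> \bar R} :=
  match s with
  | ContinuousSetup => lebesgue_measure
  | DiscreteSetup => mrestr counting measurable_range_intr
  end.

Definition pin_measure (s : setup) (eps : {nonneg R}) :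
    {measure set (measurableTypeR R) -> \bar R} :=
  measure_add (mrestr (refmeas s) (measurable_itv `]0, +oo[))
              (mscale eps (\d_(0 : measurableTypeR R))).

End reference_measure.

Section partition_functions.
Context {R : realType}.
Local Open Scope ereal_scope.

(* Integral of F (x_1, ..., x_N) over [0, +oo[^N against m^{(x) N}, as an
   iterated integral; F is only ever evaluated on sequences of size N. *)
Fixpoint integral_pos (m : {measure set (measurableTypeR R) -> \bar R})
    (N : nat) (F : seq R -> \bar R) : \bar R :=
  match N with
  | 0%N => F [::]
  | N'.+1 => \int[m]_(x in `[0%R, +oo[) integral_pos m N' (fun s => F (x :: s))
  end.

Definition energy (V : R -> \bar R) (x : seq R) : \bar R :=
  \sum_(0 <= i < (size x).-1) V (x`_i.+1 - x`_i)%R.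

Definition Hf (V : R -> \bar R) (x : seq R) : \bar R := energy V (0%R :: x).

Definition Hc (V : R -> \bar R) (x : seq R) : \bar R :=
  energy V (0%R :: rcons x 0%R).

Definition Zf (s : setup) (V : R -> \bar R) (eps : {nonneg R}) (N : nat) :=
  integral_pos (pin_measure s eps) N (fun x => expeR (- Hf V x)).

(* For N = 0 this unfolds to exp(- V 0). *)
Definition Zc (s : setup) (V : R -> \bar R) (eps : {nonneg R}) (N : nat) :=
  integral_pos (pin_measure s eps) N (fun x => expeR (- Hc V x)).

Definition kappa (s : setup) (V : R -> \bar R) : \bar R :=
  \int[refmeas s]_y expeR (- V y).

Definition gamma (s : setup) (V : R -> \bar R) : \bar R :=
  \sum_(1 <= n <oo)
    Zc s V (0%:nng)%R n.-1 * ((fine (kappa s V) ^+ n)^-1)%:E.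

Lemma integral_pos_ge0 (m : {measure set (measurableTypeR R) -> \bar R})
    (N : nat) (F : seq R -> \bar R) :
  (forall x, 0 <= F x) -> 0 <= integral_pos m N F.
Proof.
elim: N F => [|N IHN] F F0 //=.
by apply: integral_ge0 => x _; apply: IHN.
Qed.

Lemma gamma_ge0 (s : setup) (V : R -> \bar R) : 0 <= gamma s V.
Proof.
apply: nneseries_ge0 => n _ _; apply: mule_ge0.
  by apply: integral_pos_ge0 => x; exact: expeR_ge0.
rewrite lee_fin invr_ge0 exprn_ge0// fine_ge0//.
by apply: integral_ge0 => y _; exact: expeR_ge0.
Qed.

Local Open Scope ring_scope.

Definition qlaw (s : setup) (V : R -> \bar R) (n : nat) : R :=
  (fine (gamma s V))^-1 * (fine (Zc s V 0%:nng n.-1) / fine (kappa s V) ^+ n).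

Definition eps_of (s : setup) (V : R -> \bar R) (delta : {nonneg R}) :
    {nonneg R} :=
  (delta%:num / (NngNum (fine_ge0 (gamma_ge0 s V)))%:num)%:nng.

Definition Ztc (s : setup) (V : R -> \bar R) (delta : {nonneg R}) (N : nat)
    : R :=
  if N is N'.+1 then
    (delta%:num / fine (gamma s V)) * fine (Zc s V (eps_of s V delta) N')
      / fine (kappa s V) ^+ N
  else 1.

Definition Ztf (s : setup) (V : R -> \bar R) (delta : {nonneg R}) (N : nat)
    : R :=
  fine (Zf s V (eps_of s V delta) N) / fine (kappa s V) ^+ N.

End partition_functions.

(* The steps are indexed from 0: Y 0 is the step Y_1 of the walk. *)
Section random_walk.
Context {d : measure_display} {T : measurableType d} {R : realType}.
Variable P : probability T R.

Definition mutually_independent (Y : nat -> {RV P >-> R}) : Prop :=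
  forall J : seq nat, uniq J ->
  forall A : nat -> set R, (forall i, measurable (A i)) ->
    P (\bigcap_(i in [set` J]) (Y i @^-1` A i)) =
      (\prod_(i <- J) P (Y i @^-1` A i))%E.

Definition gibbs_step (s : setup) (V : R -> \bar R) (X : {RV P >-> R}) : Prop :=
  forall A : set R, measurable A ->
    distribution P X A =
      ((fine (kappa s V))^-1%:E * \int[refmeas s]_(x in A) expeR (- V x))%E.

Definition iid_gibbs (s : setup) (V : R -> \bar R) (Y : nat -> {RV P >-> R})
    : Prop :=
  mutually_independent Y /\ forall i, gibbs_step s V (Y i).

Definition walk (Y : nat -> {RV P >-> R}) (n : nat) (w : T) : R :=
  \sum_(i < n) Y i w.

Definition truncated_variance (X : {RV P >-> R}) (t : R) : R :=
  fine 'E_P[fun w => (`|X w| ^+ 2 * \1_[set w' | `|X w'| <= t] w)%R]%E.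

Definition positivity_prob (Y : nat -> {RV P >-> R}) (n : nat) : R :=
  fine (P [set w | forall i, (1 <= i <= n)%N -> 0 < walk Y i w]).

(* L is the norming function of the walk: slowly varying with
   L(x) ~ 1 / sqrt (Var(sqrt x / L x)); this determines L up to asymptotic
   equivalence. *)
Definition norming_function (X : {RV P >-> R}) (L : R -> R) : Prop :=
  slowly_varying L /\
  asymp_equiv +oo L
    (fun x => 1 / Num.sqrt (truncated_variance X (Num.sqrt x / L x))).

End random_walk.

(* Main.v *)
Require Import Defs.
From HB Require Import structures.
From mathcomp Require Import finmap.
From mathcomp Require Import all_boot all_order all_algebra.
From mathcomp Require Import all_classical all_reals all_analysis.
From mathcomp Require Import measurable_realfun.
From mathcomp Require Import lra zify ring.
Set Implicit Arguments.
Unset Strict Implicit.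
Unset Printing Implicit Defensive.
Import Order.TTheory GRing.Theory Num.Theory numFieldNormedType.Exports.
Local Open Scope classical_set_scope.
Local Open Scope ring_scope.

(** Both partition functions are renewal quantities. Let q be the return law and
    P n the probability that the walk stays positive for n steps.

    Cutting a pinned path at its first visit to 0 ([first_zero]) shows that
    u N = Ztc N satisfies u 0 = 1 and u N = delta * sum_k q k * u (N - k): u is a
    renewal sequence with defect 1 - delta, of total mass M = 1 / (1 - delta)
    ([renewal_sum]). Cutting at the last visit to 0 instead ([last_zero]), the
    piece that follows it is an unpinned positive path of free end, which weighs
    kappa^n * P n ([positive_walk_prob]); hence Ztf is the convolution of u
    and P.

    What remains is the principle of one big jump. If a is summable with mass A
    and b is regularly varying, then the part k <= N / 2 of the convolution sum
    of a k * b (N - k) is A * b N * (1 + o(1)), by dominated convergence, as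
    b (N - k) / b N tends to 1 and is bounded ([half_convolution]).

    - Constrained case. In the renewal equation the jump is made by q or by u.
      The ratio r = u / q satisfies r = delta * (M + mean of r) + o(1), where the
      mean is over indices in [N/2, N[. This is a contraction of factor delta,
      and its fixed point is delta / (1 - delta)^2 ([renewal_asymp]).
    - Free case. The part k <= N / 2 gives M * P N. The part k > N / 2 is
      negligible: up to slowly varying factors it is N^(-3/2) times the sum of
      P j over j <= N / 2, that is N^(-1), against N^(-1/2)
      ([tail_convolution]).

    The regularity used on sequences, namely limits of ratios at neighbouring
    integers, comparison within a factor 2 and crude power bounds, follows from
    the uniform convergence theorem for slowly varying functions
    ([uniform_shift]).

    On the measure-theoretic side, partition functions are iterates of transfer
    operators on nonnegative measurable functions, for which cutting paths is
    linear algebra. In the discrete set-up the potential may fail to be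
    measurable off the integers and the reference measure is invariant under
    integer translations only, so weight and walk are first restricted to the
    lattice, where everything has full measure. *)

(** * Dominated convergence and contraction for sequences *)

Section summation.
Context {R : realType}.

Lemma cvg_near0 (u : nat -> R) :
  (forall e : R, 0 < e -> \forall n \near \oo, `|u n| <= e) -> u @ \oo --> (0 : R).
Proof.
move=> H; apply/cvgrPdist_le => e e0.
by near do rewrite sub0r normrN; exact: H.
Unshelve. all: by end_near. Qed.

Lemma series_le_lim (a : nat -> R) (A : R) :
  (forall k, 0 <= a k) -> series a @ \oo --> A -> forall n, series a n <= A.
Proof.
move=> a0 aA n; rewrite -(cvg_lim (@Rhausdorff R) aA).
apply: nondecreasing_cvgn_le; last by apply/cvg_ex; exists A.
by apply: nondecreasing_series => k _ _; exact: a0.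
Qed.

Lemma tannery0 (a : nat -> R) (A : R) (w : nat -> nat -> R) (C : R) :
  (forall k, 0 <= a k) -> series a @ \oo --> A ->
  (\forall N \near \oo, forall k, `|w N k| <= C) ->
  (forall k, w ^~ k @ \oo --> (0 : R)) ->
  \sum_(0 <= k < N.+1) a k * w N k @[N --> \oo] --> (0 : R).
Proof.
move=> a0 aA wC w0; apply: cvg_near0 => e e0.
have C0 : 0 <= C.
  near \oo => N; apply: le_trans (normr_ge0 (w N 0%N)) _.
  by move: 0%N; near: N.
have D0 : 0 < C + 1 by rewrite ltr_wpDl.
have [M AM] : exists M, `|A - series a M| <= e / (2 * (C + 1)).
  near \oo => M; exists M.
  near: M; move/cvgrPdist_le : aA; apply.
  by rewrite divr_gt0// mulr_gt0.
have fin0 : \sum_(0 <= k < M) a k * `|w N k| @[N --> \oo] --> (0 : R).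
  elim: M {AM} => [|M IH]; first by under eq_fun do rewrite big_geq//; exact: cvg_cst.
  under eq_fun do rewrite big_nat_recr//=.
  have w0M : `|w N M| @[N --> \oo] --> (0 : R).
    by rewrite -(normr0 R); apply: cvg_norm; exact: w0.
  have := cvgD IH (cvgM (cvg_cst (a M)) w0M).
  by rewrite mulr0 addr0; exact.
have : \forall N \near \oo, \sum_(0 <= k < M) a k * `|w N k| <= e / 2.
  move/cvgrPdist_le : fin0 => /(_ (e / 2)); rewrite divr_gt0// => /(_ isT).
  apply: filterS => N; rewrite sub0r normrN; apply: le_trans; exact: ler_norm.
move=> finM; near=> N.
have MN : (M <= N.+1)%N by rewrite leqW//; near: N; exact: nbhs_infty_ge.
rewrite (big_cat_nat (leq0n M) MN)//=.
apply: le_trans (ler_normD _ _) _.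
rewrite (_ : e = e / 2 + e / 2); last by field.
apply: lerD.
  apply: le_trans (ler_norm_sum _ _ _) _.
  under eq_bigr do rewrite normrM (ger0_norm (a0 _)).
  by near: N.
apply: le_trans (ler_norm_sum _ _ _) _.
apply: (@le_trans _ _ ((C + 1) * \sum_(M <= k < N.+1) a k)).
  rewrite mulr_sumr; apply: ler_sum => k _.
  rewrite normrM (ger0_norm (a0 _)) mulrC ler_wpM2r//.
  apply: (@le_trans _ _ C); last by rewrite lerDl.
  by move: k; near: N.
apply: (@le_trans _ _ ((C + 1) * `|A - series a M|)); last first.
  by rewrite mulrC -ler_pdivlMr// -mulrA -invfM.
rewrite ler_wpM2l//; first exact: ltW.
apply: le_trans (ler_norm _).
have := series_le_lim a0 aA N.+1.
rewrite /series /= (big_cat_nat (leq0n M) MN)//=; lra.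
Unshelve. all: by end_near. Qed.

(** Tannery's theorem, the form of dominated convergence used for every
    convolution below. *)
Lemma tannery (a : nat -> R) (A : R) (w : nat -> nat -> R) (l C : R) :
  (forall k, 0 <= a k) -> series a @ \oo --> A ->
  (\forall N \near \oo, forall k, `|w N k| <= C) ->
  (forall k, w ^~ k @ \oo --> l) ->
  \sum_(0 <= k < N.+1) a k * w N k @[N --> \oo] --> A * l.
Proof.
move=> a0 aA wC wl.
have -> : (fun N => \sum_(0 <= k < N.+1) a k * w N k) =
   (fun N => \sum_(0 <= k < N.+1) a k * (w N k - l)) + (fun N => series a N.+1 * l).
  apply/funext => N; rewrite fctE /series /= mulr_suml -big_split /=.
  by apply: eq_bigr => k _; ring.
rewrite -[A * l]add0r; apply: cvgD.
  apply: (@tannery0 a A _ (C + `|l|)) => //.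
    near=> N => k; apply: le_trans (ler_normB _ _) _.
    by rewrite lerD2r; move: k; near: N.
  by move=> k; rewrite -(subrr l); apply: cvgB; [exact: wl|exact: cvg_cst].
apply: cvgM; last exact: cvg_cst.
by rewrite (cvg_shiftS (series a)).
Unshelve. all: by end_near. Qed.

(** The hypothesis bounds e N by its values on [N/2, N[ only. It first makes e
    bounded; each further doubling of N then improves the bound by a factor
    rho, up to an error that vanishes with eta. *)
Lemma contraction_cvg0 (e eta : nat -> R) (rho : R) :
  0 <= rho < 1 -> (forall n, 0 <= e n) -> eta @ \oo --> (0 : R) ->
  (\forall N \near \oo, forall B,
     (forall j, (N - N./2 <= j < N)%N -> e j <= B) -> e N <= eta N + rho * B) ->
  e @ \oo --> (0 : R).
Proof.
move=> /andP[rho0 rho1] e0 eta0 H.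
have etaE d : 0 < d -> \forall n \near \oo, eta n <= d.
  move=> d0; move/cvgrPdist_le : eta0 => /(_ _ d0); apply: filterS => n.
  by rewrite sub0r normrN; apply: le_trans; exact: ler_norm.
have r1 : 0 < 1 - rho by lra.
have [B0 HB0] : exists B, forall n, e n <= B.
  have [N1 _ N1H] : \forall N \near \oo, eta N <= 1 /\ (forall B,
     (forall j, (N - N./2 <= j < N)%N -> e j <= B) -> e N <= eta N + rho * B).
    by near=> N; split; near: N => //; exact: etaE.
  (* 1 + rho * B <= B as soon as B is at least (1 - rho)^-1 *)
  pose B := \sum_(0 <= j < N1) e j + 1 / (1 - rho).
  exists B => n; elim/ltn_ind: n => n IH.
  have B1 : 1 <= (1 - rho) * B.
    rewrite mulrC -ler_pdivrMr// lerDr; exact: sumr_ge0.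
  have [nN1|N1n] := ltnP n N1.
    rewrite /B (bigD1_seq n)//= ?mem_index_iota ?iota_uniq//.
    rewrite -addrA lerDl addr_ge0 ?sumr_ge0//.
    by rewrite ltW// divr_gt0.
  have [etan1 Hn] := N1H n N1n.
  have := Hn B (fun j => fun h => IH j (proj2 (andP h))).
  lra.
have B00 : 0 <= B0 by exact: le_trans (e0 0%N) (HB0 _).
have step k : forall d, 0 < d -> \forall n \near \oo, e n <= rho ^+ k * B0 + d.
  elim: k => [|k IH] d d0.
    by near=> n; rewrite expr0 mul1r ler_wpDr// ltW.
  have [N1 _ N1H] := IH _ d0.
  near=> N.
  have HN : forall B,
     (forall j, (N - N./2 <= j < N)%N -> e j <= B) -> e N <= eta N + rho * B.
    by near: N.
  have etaN : eta N <= d * (1 - rho) by near: N; apply: etaE; rewrite mulr_gt0.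
  have : e N <= eta N + rho * (rho ^+ k * B0 + d).
    apply: HN => j /andP[jN _]; apply: N1H => /=; apply: leq_trans jN.
    have : (N1.*2 <= N)%N by near: N; exact: nbhs_infty_ge.
    by lia.
  rewrite exprS; lra.
apply: cvg_near0 => d d0.
have : rho ^+ k * B0 @[k --> \oo] --> (0 : R).
  rewrite -[0](mul0r B0); apply: cvgM; last exact: cvg_cst.
  by apply: cvg_expr; rewrite ger0_norm.
move/cvgrPdist_le => /(_ (d / 2)); rewrite divr_gt0// => /(_ isT)[k _ /(_ k)].
rewrite /= leqnn sub0r normrN => /(_ isT) kd.
have := step k (d / 2); rewrite divr_gt0// => /(_ isT); apply: filterS => n.
rewrite (ger0_norm (e0 n)) => /le_trans; apply.
have := ler_norm (rho ^+ k * B0); lra.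
Unshelve. all: by end_near. Qed.

End summation.

(** * Convolution with locally regular sequences *)

Section locally_regular.
Context {R : realType}.
Implicit Types a b : nat -> R.

(** What convolution arguments need from a regularly varying sequence: it is
    positive and long-tailed, and its values within a factor 2 of the index are
    comparable. The comparison is the domination in Tannery's theorem. *)
Definition locally_regular (b : nat -> R) : Prop :=
  [/\ \forall n \near \oo, 0 < b n,
      b n.+1 / b n @[n --> \oo] --> (1 : R) &
      exists C : R, \forall n \near \oo, forall m, (n <= m <= n.*2)%N ->
        b n <= C * b m /\ b m <= C * b n].

Lemma locally_regular_shift b k : locally_regular b ->
  b (N - k)%N / b N @[N --> \oo] --> (1 : R).
Proof.
move=> [b0 b1 _]; have [n0 _ n0H] := b0.
elim: k => [|k IH].
  apply: cvg_near_cst.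
  by near=> N; rewrite subn0 divff// gt_eqF//; near: N.
have bV : b n / b n.+1 @[n --> \oo] --> (1 : R).
  rewrite -(invr1 R); under eq_fun do rewrite -[_ / _]invf_div.
  by apply: cvgV => //; exact: oner_neq0.
rewrite -(cvg_shiftS (fun N => b (N - k.+1)%N / b N)) /=.
under eq_fun do rewrite subSS.
apply: (@cvg_trans _ ((fun N => (b (N - k)%N / b N) * (b N / b N.+1)) @ \oo)).
  apply: near_eq_cvg; near=> N.
  have bN : b N != 0 by rewrite gt_eqF//; near: N.
  have bN1 : b N.+1 != 0.
    by rewrite gt_eqF//; apply: n0H => /=; rewrite leqW//; near: N; exact: nbhs_infty_ge.
  by rewrite mulrA divfK.
by have := cvgM IH bV; rewrite mulr1; exact.
Unshelve. all: by end_near. Qed.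

(** The mass of a sits at bounded k, where b (N - k) / b N tends to 1, and for
    k up to N / 2 this ratio stays bounded. The cut-off h allows both ways to
    cut a convolution in the middle: N./2.+1 terms on one side leave N - N./2
    on the other. *)
Lemma half_convolution a (A : R) b (h : nat -> nat) :
  (forall k, 0 <= a k) -> series a @ \oo --> A -> locally_regular b ->
  (forall N, N./2 <= h N <= N./2.+1)%N ->
  \sum_(0 <= k < h N) a k * (b (N - k)%N / b N) @[N --> \oo] --> A.
Proof.
move=> a0 aA rb hN; have [b0 b1 [C bC]] := rb.
pose w N k : R := if (k < h N)%N then b (N - k)%N / b N else 0.
rewrite (_ : (fun _ => _) = (fun N => \sum_(0 <= k < N.+1) a k * w N k)); last first.
  apply/funext => N.
  have hN1 : (h N <= N.+1)%N by have := hN N; lia.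
  rewrite (big_cat_nat (leq0n _) hN1)/= [X in _ + X]big1_seq ?addr0.
    by apply: eq_big_nat => k /andP[_ kh]; rewrite /w kh.
  move=> k /=; rewrite mem_index_iota => /andP[hk _].
  by rewrite /w ltnNge hk mulr0.
rewrite -[A]mulr1; apply: (@tannery _ _ _ _ _ C) => //.
- have [n0 _ n0H] : \forall n \near \oo, 0 < b n /\ forall m, (n <= m <= n.*2)%N ->
        b n <= C * b m /\ b m <= C * b n by near=> n; split; near: n.
  near=> N => k; rewrite /w.
  have N0 : (n0.*2 <= N)%N by near: N; exact: nbhs_infty_ge.
  have bN : 0 < b N by apply: (n0H N _).1 => /=; lia.
  case: ifPn => kh.
    have h1 : (n0 <= N - k)%N by have := hN N; lia.
    have [_ /(_ N)[|bNk _]] := n0H _ h1; first by have := hN N; lia.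
    have bNk0 : 0 < b (N - k)%N by apply: (n0H _ h1).1.
    by rewrite gtr0_norm ?divr_gt0// ler_pdivrMr.
  rewrite normr0.
  have [_ /(_ N)[|+ _]] := n0H N ltac:(rewrite /=; lia); first by lia.
  by rewrite -ler_pdivrMr// divff ?gt_eqF//; exact: le_trans.
- move=> k.
  apply: cvg_trans (locally_regular_shift k rb).
  apply: near_eq_cvg; near=> N; rewrite /w ifT//.
  have : (k.+1.*2 <= N)%N by near: N; exact: nbhs_infty_ge.
  by have := hN N; lia.
Unshelve. all: by end_near. Qed.

End locally_regular.

(** * Defective renewal sequences *)

Section renewal.
Context {R : realType}.
Variables (q u : nat -> R) (delta : R).
Hypotheses (delta0 : 0 < delta) (delta1 : delta < 1).
Hypotheses (q0 : q 0%N = 0) (q_ge0 : forall n, 0 <= q n).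
Hypothesis q1 : series q @ \oo --> (1 : R).
Hypothesis u0 : u 0%N = 1.
Hypothesis uS : forall N, (0 < N)%N ->
  u N = delta * \sum_(0 <= k < N.+1) q k * u (N - k)%N.

Lemma renewal_ge0 n : 0 <= u n.
Proof.
elim/ltn_ind: n => -[|n] IH; first by rewrite u0.
rewrite uS// mulr_ge0 ?(ltW delta0)// big_nat_recl// q0 mul0r add0r big_nat.
apply: sumr_ge0 => k /andP[_ kn].
by rewrite mulr_ge0//; apply: IH; lia.
Qed.

Local Notation U := ((1 - delta)^-1).

(** Summation of the renewal equation, with the sum over triangles taken along
    the other side. *)
Lemma renewal_partial_sum n : series u n.+1 =
  1 + delta * \sum_(0 <= k < n.+1) q k * series u (n.+1 - k)%N.
Proof.
rewrite /series /= big_nat_recl// u0; congr (_ + _).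
elim: n => [|n IH].
  by rewrite big_geq// big_nat1 q0 mul0r mulr0.
rewrite big_nat_recr//= IH uS// -mulrDr; congr (_ * _).
rewrite [in RHS]big_nat_recr//= [X in _ + X = _]big_nat_recr//=.
rewrite subnn u0 subSnn big_nat1 u0 addrA; congr (_ + _).
rewrite -big_split /= [LHS]big_nat_cond [RHS]big_nat_cond.
apply: eq_bigr => k /andP[/andP[_ kn] _].
by rewrite -mulrDr [in RHS]subSn ?big_nat_recr//=; lia.
Qed.

(** The total mass M solves M = 1 + delta * M, by Tannery's theorem in
    [renewal_partial_sum]. *)
Lemma renewal_sum : series u @ \oo --> U.
Proof.
have U0 : 0 < U by rewrite invr_gt0 subr_gt0.
have nd : nondecreasing_seq (series u).
  by apply: nondecreasing_series => k _ _; exact: renewal_ge0.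
have s0 n : 0 <= series u n by exact: sumr_ge0 (fun _ _ => renewal_ge0 _).
have ub n : series u n <= U.
  have [->|n0] := posnP n; first by rewrite /series /= big_geq// ltW.
  rewrite -(prednK n0).
  have : series u n.-1.+1 <= 1 + delta * series u n.-1.+1.
    rewrite {1}renewal_partial_sum lerD2l ler_wpM2l ?(ltW delta0)//.
    apply: (@le_trans _ _ (\sum_(0 <= k < n.-1.+1) q k * series u n.-1.+1)).
      by apply: ler_sum => k _; rewrite ler_wpM2l//; apply: nd; exact: leq_subr.
    by rewrite -mulr_suml ler_piMl//; exact: series_le_lim q_ge0 q1 _.
  by rewrite -[_^-1]mul1r ler_pdivlMr ?subr_gt0//; lra.
have cvu : cvgn (series u).
  apply: nondecreasing_is_cvgn => //.
  by exists U => _ [n _ <-].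
suff -> : U = limn (series u) by [].
have h : \sum_(0 <= k < n.+1) q k * series u (n.+1 - k)%N @[n --> \oo] -->
    1 * limn (series u).
  apply: (@tannery _ _ _ (fun n k => series u (n.+1 - k)%N) _ U) => //.
    by near=> n => k; rewrite ger0_norm.
  move=> k; apply/cvgrPdist_le => e e0.
  move: cvu => /cvgrPdist_le/(_ _ e0)[n0 _ n0H].
  near=> n; apply: n0H => /=.
  have : (n0 + k <= n)%N by near: n; exact: nbhs_infty_ge.
  lia.
have : limn (series u) = 1 + delta * (1 * limn (series u)).
  have e1 : series u n.+1 @[n --> \oo] --> limn (series u).
    by rewrite (cvg_shiftS (series u)).
  move: e1; under eq_fun do rewrite renewal_partial_sum.
  move=> e1; apply: (cvg_unique (@Rhausdorff R) e1).
  by apply: cvgD; [exact: cvg_cst|apply: cvgM => //; exact: cvg_cst].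
rewrite mul1r => ll; apply: (@mulfI _ (1 - delta)); first by rewrite subr_eq0 gt_eqF.
by rewrite divff ?subr_eq0 ?gt_eqF//; lra.
Unshelve. all: by end_near. Qed.

Hypothesis rq : locally_regular q.

Lemma renewal_split N : (0 < N)%N -> u N =
  delta * (\sum_(0 <= k < N./2.+1) q k * u (N - k)%N +
           \sum_(0 <= k < N - N./2) u k * q (N - k)%N).
Proof.
move=> N0; rewrite uS//; congr (_ * _).
have hN : (N./2.+1 <= N.+1)%N by lia.
rewrite (big_cat_nat (leq0n _) hN)/=; congr (_ + _).
rewrite -{1}[N./2.+1]add0n big_addn subSS big_nat_rev/= [LHS]big_nat_cond [RHS]big_nat_cond.
apply: eq_bigr => k /andP[/andP[_ kn] _].
rewrite mulrC; congr (u _ * q _); lia.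
Qed.

(** A big jump: either the last renewal or the path before it is long. In the
    ratio r = u / q the two halves of [renewal_split] read
    r N = delta * (M + weighted mean of r over [N/2, N[) + o(1) with
    M = (1 - delta)^-1, so the distance of r to the fixed point of
    r = delta * (M + r) contracts by delta. *)
Lemma renewal_asymp : u N / q N @[N --> \oo] --> delta / (1 - delta) ^+ 2.
Proof.
have [qpos _ _] := rq.
have [n0 _ n0H] := qpos.
have d1 : 0 < 1 - delta by rewrite subr_gt0.
have d0 := delta0.
have rho01 : 0 <= (1 + delta) / 2 < 1 by apply/andP; split; lra.
(* rU is the fixed-point equation that determines the limit. *)
set r := delta / _.
have rU : r = delta * (U + 1 * r) by rewrite /r; field; rewrite gt_eqF.
have r0 : 0 <= r by rewrite /r divr_ge0 ?sqr_ge0// ltW.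
clearbody r.
pose A N := \sum_(0 <= k < N - N./2) u k * (q (N - k)%N / q N).
pose W N := \sum_(0 <= k < N./2.+1) q k * (q (N - k)%N / q N).
have cA : A @ \oo --> U.
  by apply: half_convolution => //; [exact: renewal_ge0|exact: renewal_sum|lia].
have cW : W @ \oo --> (1 : R).
  by apply: half_convolution => //; lia.
pose eta N := delta * `|A N - U| + delta * r * `|W N - 1|.
have ceta : eta @ \oo --> (0 : R).
  rewrite (_ : 0 = delta * `|U - U| + delta * r * `|1 - 1|); last first.
    by rewrite !subrr normr0 !mulr0 addr0.
  by apply: cvgD; (apply: cvgM; first exact: cvg_cst); apply: cvg_norm;
    apply: cvgB => //; exact: cvg_cst.
pose e N := `|u N / q N - r|.
suff ce : e @ \oo --> (0 : R).
  apply/cvgrPdist_le => x x0; move/cvgrPdist_le : ce => /(_ _ x0).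
  by apply: filterS => n; rewrite sub0r normrN normr_id distrC.
(* The weights W N have sum 1 only in the limit, hence a factor in ]delta, 1[ *)
apply: (@contraction_cvg0 R e eta ((1 + delta) / 2) _ _ ceta) => //.
  by move=> n; exact: normr_ge0.
have cdW : delta * W N @[N --> \oo] --> delta.
  by rewrite -[X in _ --> X]mulr1; apply: cvgM => //; exact: cvg_cst.
have cdW1 : \forall N \near \oo, delta * W N <= (1 + delta) / 2.
  have d2 : 0 < (1 - delta) / 2 by lra.
  move/cvgrPdist_le : cdW => /(_ _ d2); apply: filterS => n.
  have := ler_norm (delta * W n - delta); rewrite distrC; lra.
near=> N => B HB.
have N2 : (2 <= N)%N by near: N; exact: nbhs_infty_ge.
have Nn0 : (n0.*2 <= N)%N by near: N; exact: nbhs_infty_ge.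
have qN : 0 < q N by apply: n0H => /=; lia.
have B0 : 0 <= B.
  by apply: (@le_trans _ _ (e N.-1)); [exact: normr_ge0|apply: HB; lia].
have dW : delta * W N <= (1 + delta) / 2 by near: N.
pose X := \sum_(0 <= k < N./2.+1)
  q k * (q (N - k)%N / q N) * (u (N - k)%N / q (N - k)%N - r).
have eN : u N / q N - r = delta * X + delta * r * (W N - 1) + delta * (A N - U).
  rewrite renewal_split; last by lia.
  have -> : X = (\sum_(0 <= k < N./2.+1) q k * u (N - k)%N) / q N - r * W N.
    rewrite /X /W mulr_suml mulr_sumr -sumrB [LHS]big_nat_cond [RHS]big_nat_cond.
    apply: eq_bigr => k /andP[/andP[_ kN] _].
    have qNk : q (N - k)%N != 0.
      by rewrite gt_eqF//; apply: n0H => /=; lia.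
    by field; rewrite qNk gt_eqF.
  have -> : \sum_(0 <= k < N - N./2) u k * q (N - k)%N = A N * q N.
    rewrite /A mulr_suml; apply: eq_bigr => k _.
    by rewrite -mulrA divfK ?gt_eqF.
  rewrite [in LHS]rU -mulrA mulrDl mulfK ?gt_eqF//; ring.
have XB : `|X| <= W N * B.
  rewrite /W mulr_suml; apply: le_trans (ler_norm_sum _ _ _) _.
  rewrite [leLHS]big_nat_cond [leRHS]big_nat_cond.
  apply: ler_sum => k /andP[/andP[_ kN] _].
  (* q 0 = 0 keeps the bound on indices j < N *)
  have [->|k0] := posnP k; first by rewrite q0 !mul0r normr0.
  have w0 : 0 <= q k * (q (N - k)%N / q N).
    by rewrite mulr_ge0// divr_ge0// ltW.
  rewrite normrM (ger0_norm w0) ler_wpM2l//; apply: HB; lia.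
rewrite {1}/e eN; apply: le_trans (ler_normD _ _) _.
apply: le_trans (lerD (ler_normD _ _) (lexx _)) _.
rewrite !normrM (gtr0_norm delta0) (ger0_norm r0) /eta.
have : delta * `|X| <= (1 + delta) / 2 * B.
  apply: (@le_trans _ _ (delta * W N * B)); last exact: ler_wpM2r.
  by rewrite -mulrA ler_wpM2l// ltW.
lra.
Unshelve. all: by end_near. Qed.

End renewal.

(** * The uniform convergence theorem for slowly varying functions *)

Section slow_variation.
Context {R : realType}.

Lemma measurable_addl (c : R) :
  measurable_fun setT (fun x : measurableTypeR R => c + x : measurableTypeR R).
Proof. exact: measurable_funD. Qed.

Lemma lebesgue_measure_translation (c : R) (A : set R) : measurable A ->
  pushforward lebesgue_measure (fun x : measurableTypeR R => c + x : measurableTypeR R) A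
  = lebesgue_measure A.
Proof.
move=> mA; have mc := measurable_addl c.
apply/esym.
pose mcf := HB.pack (fun x : measurableTypeR R => c + x : measurableTypeR R)
  (isMeasurableFun.Build _ _ _ _ _ mc) : {mfun measurableTypeR R >-> measurableTypeR R}.
apply: (@lebesgue_measure_unique R (pushforward lebesgue_measure mcf)) => // _ [[a b]] _ <-.
rewrite /pushforward /=.
set B := (X in _ = lebesgue_measure X).
have -> : B = `]a - c, b - c]%classic.
  by apply/seteqP; split => x; rewrite /B/= !in_itv/= => /andP[h1 h2]; apply/andP; split; lra.
rewrite !lebesgue_measure_itv/= !lte_fin ltrD2r.
by case: ifP => // _; rewrite -!EFinB; congr EFin; ring.
Qed.

Lemma uniform_cvg_le (D : set R) (f : nat -> R -> R) (g : R -> R) (e : R) : 0 < e ->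
  {uniform D, f @ \oo --> g} -> \forall n \near \oo, forall t, D t -> `|g t - f n t| < e.
Proof.
move=> e0 H.
apply: (H [set h | forall t, D t -> `|g t - h t| < e]).
apply/uniform_nbhs; exists [set xy | ball xy.1 e xy.2]; split => //.
exact: entourage_ball (PosNum e0).
Qed.

(** The uniform convergence theorem of Karamata theory, in additive form.
    Otherwise h (x n + c n) - h (x n) stays away from 0 along some sequences
    with x n going to infinity and c n in [0, 1]. By Egorov's theorem, for n
    large, h (x n + t) - h (x n) and h (x n + c n + s) - h (x n + c n) are
    small for s and t in [0, 2] outside two sets of measure less than 1 / 4. By
    translation invariance some s in [0, 1] is such that s and t = s + c n
    avoid both sets; the two points then coincide. *)
Lemma uniform_shift (h : R -> R) (X : R) :
  measurable_fun `[X, +oo[ h ->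
  (forall u : R, 0 <= u -> h (x + u) - h x @[x --> +oo] --> (0 : R)) ->
  forall e : R, 0 < e -> exists Y : R, forall x, Y <= x -> forall u, 0 <= u <= 1 ->
    `|h (x + u) - h x| <= e.
Proof.
move=> mh hu e e0; apply: contrapT => /forallNP H.
have {H}H n : exists xu : R * R, [/\ X <= xu.1, n%:R <= xu.1, 0 <= xu.2 <= 1 &
    e < `|h (xu.1 + xu.2) - h xu.1|].
  move: (H (Num.max X n%:R)) => /existsNP[x /not_implyP[+ /existsNP[u /not_implyP[u01 +]]]].
  by rewrite ge_max => /andP[? ?] /negP; rewrite -ltNge => ?; exists (x, u).
have [xu xuP] := choice H.
pose x n := (xu n).1; pose c n := (xu n).2; pose y n := x n + c n.
have xX n : X <= x n by have [] := xuP n.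
have c01 n : 0 <= c n <= 1 by have [] := xuP n.
have yX n : X <= y n.
  by apply: le_trans (xX n) _; rewrite lerDl; have /andP[] := c01 n.
have xoo : x @ \oo --> +oo.
  apply/cvgryPge => A; near=> n; have [_ nx _ _] := xuP n; apply: le_trans nx.
  by near: n; exact: nbhs_infty_ger.
have yoo : y @ \oo --> +oo.
  apply/cvgryPge => A; move/cvgryPge : xoo => /(_ A); apply: filterS => n /le_trans; apply.
  by rewrite lerDl; have /andP[] := c01 n.
pose D := `[(0:R), 2]%classic.
have D_fin : (lebesgue_measure D < +oo)%E.
  by rewrite /D lebesgue_measure_itv/= lte_fin ltr0n/= -EFinB ltry.
have small (z : nat -> R) : (forall n, X <= z n) -> z @ \oo --> +oo ->
  exists B, [/\ measurable B, (lebesgue_measure B < (4^-1)%:E)%E &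
    \forall n \near \oo, forall t, (D `\` B) t -> `|h (z n + t) - h (z n)| < e / 2].
  move=> zX zoo.
  have [|||||B [mB B4 Bu]] := @pointwise_almost_uniform _ R (measurableTypeR R)
     lebesgue_measure (fun n t => h (z n + t) - h (z n)) (cst 0) D 4^-1.
  - move=> n; apply: measurable_funB => //.
    apply: (@measurable_comp _ _ _ _ _ _ `[X, +oo[) => //.
      move=> r [t] /=; rewrite !in_itv/= andbT => /andP[t0 _] <-.
      by apply: le_trans (zX n) _; rewrite lerDl.
    by apply: measurable_funTS; exact: measurable_addl.
  - exact: measurable_itv.
  - exact: D_fin.
  - move=> t; rewrite /D/= in_itv/= => /andP[t0 _].
    exact: (cvg_comp z (fun x => h (x + t) - h x) zoo (hu _ t0)).
  - by rewrite invr_gt0.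
  exists B; split => //.
  have e2 : 0 < e / 2 by rewrite divr_gt0.
  apply: filterS (uniform_cvg_le e2 Bu) => n + t Dt => /(_ t Dt).
  by rewrite /cst sub0r normrN.
have [B [mB B4 Bu]] := small x xX xoo.
have [C [mC C4 Cu]] := small y yX yoo.
near \oo => n.
pose E := `[(0:R), 1]%classic.
pose Bn := (fun s : measurableTypeR R => c n + s : measurableTypeR R) @^-1` B.
have mBn : measurable Bn.
  by rewrite -[Bn]setTI; exact: measurable_addl.
have Bn4 : (lebesgue_measure Bn < (4^-1)%:E)%E.
  by have := lebesgue_measure_translation (c n) mB; rewrite /pushforward => ->.
have [s [Es Bs Cs]] : exists s, [/\ E s, ~ Bn s & ~ C s].
  apply: contrapT => /forallNP K.
  have EBC : E `<=` Bn `|` C.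
    move=> s Es; apply: contrapT => /not_orP[h1 h2].
    by apply: (K s).
  have : (lebesgue_measure E <= lebesgue_measure (Bn `|` C))%E.
    apply: le_measure => //; rewrite inE; first exact: measurable_itv.
    exact: measurableU.
  apply/negP; rewrite -ltNge.
  apply: le_lt_trans; first exact: measureU2.
  have -> : lebesgue_measure E = 1%:E :> \bar R.
    by rewrite /E lebesgue_measure_itv/= lte_fin ltr01 -EFinB subr0.
  apply: lt_trans (lteD Bn4 C4) _.
  by rewrite -EFinD lte_fin; lra.
have [_ _ _] := xuP n; apply/negP; rewrite -leNgt.
move: Es; rewrite /E/= in_itv/= => /andP[s0 s1].
have /andP[c0 c1] := c01 n.
have h1 : `|h (x n + (c n + s)) - h (x n)| < e / 2.
  have : forall t, (D `\` B) t -> `|h (x n + t) - h (x n)| < e / 2 by near: n.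
  by apply; split => //; rewrite /D/= in_itv/=; apply/andP; split; lra.
have h2 : `|h (y n + s) - h (y n)| < e / 2.
  have : forall t, (D `\` C) t -> `|h (y n + t) - h (y n)| < e / 2 by near: n.
  by apply; split => //; rewrite /D/= in_itv/=; apply/andP; split; lra.
rewrite -/(x n) -/(c n) -/(y n).
rewrite addrA -/(y n) in h1.
have -> : h (y n) - h (x n) = (h (y n + s) - h (x n)) - (h (y n + s) - h (y n)).
  by ring.
by apply: le_trans (ler_normB _ _) _; lra.
Unshelve. all: by end_near. Qed.

(** [uniform_shift] for h = ln \o l \o expR; shifts in [0, 1] cover the ratios up
    to 2 because ln 2 <= 1. *)
Lemma slowly_varying_doubling (l : R -> R) : slowly_varying l ->
  forall e : R, 0 < e -> exists X : R, 0 < X /\ forall x y, X <= x -> x <= y <= 2 * x ->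
    [/\ 0 < l x, l y <= (1 + e) * l x & l x <= (1 + e) * l y].
Proof.
move=> [[X0 [ml lpos]] sv] e e0.
pose X := Num.max X0 1.
have X1 : 1 <= X by rewrite le_max lexx orbT.
have XX0 t : X <= t -> X0 <= t by rewrite ge_max => /andP[].
have expX t : X <= t -> X <= expR t.
  by move=> Xt; apply: le_trans (expR_ge1Dx t); lra.
pose h x := ln (l (expR x)).
have mh : measurable_fun `[X, +oo[ h.
  apply: measurableT_comp; first exact: measurable_ln.
  apply: (@measurable_comp _ _ _ _ _ _ `[X0, +oo[) => //.
    move=> r [t] /=; rewrite !in_itv/= !andbT => Xt <-.
    by apply: XX0; exact: expX.
  by apply: measurable_funTS; exact: measurable_expR.
have expoo : expR x @[x --> +oo] --> (+oo : set_system R).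
  apply/cvgryPge => A; near=> x.
  apply: le_trans (expR_ge1Dx x); rewrite -lerBlDl; near: x.
  by apply: nbhs_pinfty_ge; exact: num_real.
have hu u : 0 <= u -> h (x + u) - h x @[x --> +oo] --> (0 : R).
  move=> u0.
  have := cvg_comp _ _ expoo (sv (expR u) (expR_gt0 u)).
  move=> H; have H2 : ln (l (expR u * expR x) / l (expR x)) @[x --> +oo] --> ln (1:R).
    exact: (cvg_comp _ _ H (continuous_ln ltr01)).
  rewrite -ln1; apply: cvg_trans H2; apply: near_eq_cvg; near=> x.
  have Xx : X <= x by near: x; apply: nbhs_pinfty_ge; exact: num_real.
  rewrite -expRD [u + x]addrC ln_div// posrE; apply: lpos; apply: XX0; apply: expX => //.
  by rewrite ler_wpDr.
have le0 : 0 < ln (1 + e) by rewrite ln_gt0// ltrDl.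
have [Y HY] := uniform_shift mh hu le0.
exists (Num.max X (expR Y)); split; first by rewrite lt_max; apply/orP; left; lra.
move=> x y; rewrite ge_max => /andP[Xx Yx] /andP[xy yx].
have x0 : 0 < x by lra.
have y0 : 0 < y by lra.
have lx : 0 < l x by apply: lpos; exact: XX0.
have ly : 0 < l y by apply: lpos; apply: XX0; lra.
have Ylx : Y <= ln x by rewrite -[Y]expRK ler_ln ?posrE ?expR_gt0.
have := HY _ Ylx (ln (y / x)).
rewrite ln_div ?posrE// subr_ge0 ler_ln ?posrE// xy/=.
have -> : ln y - ln x <= 1.
  rewrite -ln_div ?posrE//; apply: (@le_trans _ _ (ln (1 + 1))).
    by rewrite ler_ln ?posrE ?divr_gt0// ler_pdivrMr//; lra.
  by apply: le_ln1Dx; lra.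
move=> /(_ isT); rewrite subrKC /h !lnK ?posrE// -ln_div ?posrE//.
rewrite ler_norml => /andP[]; rewrite -lnV ?posrE; last by lra.
rewrite !ler_ln ?posrE ?divr_gt0 ?invr_gt0//; last 2 first.
- by lra.
- by lra.
rewrite ler_pdivlMr// ler_pdivrMr// => h1 h2; split => //.
by rewrite -ler_pdivrMl//; lra.
Unshelve. all: by end_near. Qed.

End slow_variation.

(** * Regularly varying sequences are locally regular *)

Section regular_sequences.
Context {R : realType}.
Implicit Types a b : nat -> R.

Lemma locally_regularM a b : locally_regular a -> locally_regular b ->
  locally_regular (fun n => a n * b n).
Proof.
move=> [a0 a1 [C aC]] [b0 b1 [D bD]].
split.
- by near=> n; rewrite mulr_gt0//; near: n.
- under eq_fun do rewrite invfM mulrACA.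
  by have := cvgM a1 b1; rewrite mulr1; exact.
- exists (C * D).
  have [n0 _ n0H] : \forall n \near \oo, 0 < a n /\ 0 < b n.
    by near=> n; split; near: n.
  near=> n => m nm.
  have [] : a n <= C * a m /\ a m <= C * a n by move: m nm; near: n.
  have [] : b n <= D * b m /\ b m <= D * b n by move: m nm; near: n.
  have nn0 : (n0 <= n)%N by near: n; exact: nbhs_infty_ge.
  have [an bn] := n0H n nn0.
  have [am bm] := n0H m (leq_trans nn0 (proj1 (andP nm))).
  by move=> b1' b2' a1' a2'; split; rewrite mulrACA ler_pM// ltW.
Unshelve. all: by end_near. Qed.

Lemma locally_regular_equiv a b : locally_regular b -> asymp_equiv \oo a b ->
  locally_regular a.
Proof.
move=> [b0 b1 [C bC]]; rewrite /asymp_equiv => ab.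
have ab2 : \forall n \near \oo, [/\ 0 < b n, b n <= 2 * a n & a n <= 2 * b n].
  move/cvgrPdist_le : ab => /(_ 2^-1); rewrite invr_gt0 ltr0n => /(_ isT) ab.
  near=> n.
  have bn : 0 < b n by near: n.
  have : `|1 - a n / b n| <= 2^-1 by near: n.
  rewrite ler_norml => /andP[h1 h2].
  have {}h1 : a n / b n <= 2 by lra.
  have {}h2 : 2^-1 <= a n / b n by lra.
  split => //; last by rewrite -ler_pdivrMr.
  by move: h2; rewrite ler_pdivlMr//; lra.
have [n0 _ n0H] := ab2.
split.
- near=> n; have nn0 : (n0 <= n)%N by near: n; exact: nbhs_infty_ge.
  by have [] := n0H n nn0; lra.
- have r1 : a n.+1 / b n.+1 @[n --> \oo] --> (1 : R).
    by rewrite (cvg_shiftS (fun n => a n / b n)).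
  have r2 : b n / a n @[n --> \oo] --> (1 : R).
    rewrite -(invr1 R); under eq_fun do rewrite -[_ / _]invf_div.
    exact: (cvgV (oner_neq0 R) ab).
  have r3 : a n.+1 / b n.+1 * (b n.+1 / b n) * (b n / a n) @[n --> \oo] --> (1 : R).
    by have := cvgM (cvgM r1 b1) r2; rewrite !mulr1; exact.
  apply: cvg_trans r3; apply: near_eq_cvg; near=> n.
  have nn0 : (n0 <= n)%N by near: n; exact: nbhs_infty_ge.
  have [bn h1 _] := n0H n nn0.
  have [bn1 h3 _] := n0H n.+1 (leqW nn0).
  have an : 0 < a n by lra.
  field.
  by rewrite !gt_eqF.
- exists (4 * C); near=> n => m nm.
  have [] : b n <= C * b m /\ b m <= C * b n by move: m nm; near: n.
  have nn0 : (n0 <= n)%N by near: n; exact: nbhs_infty_ge.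
  have [bn h1 h2] := n0H n nn0.
  have [bm h3 h4] := n0H m (leq_trans nn0 (proj1 (andP nm))).
  move=> h5 h6.
  have C0 : 0 <= C by rewrite -(pmulr_lge0 _ bm); lra.
  have := ler_wpM2l C0 h1; have := ler_wpM2l C0 h3.
  by split; lra.
Unshelve. all: by end_near. Qed.

Lemma cvg_ratio_nat : (n.+1%:R / n%:R : R) @[n --> \oo] --> (1 : R).
Proof.
rewrite -(cvg_shiftS (fun n => n.+1%:R / n%:R : R)).
rewrite (_ : (fun _ => _) = (fun n => 1 + harmonic n)).
  by have := cvgD (cvg_cst (1 : R)) (@cvg_harmonic R); rewrite addr0; exact.
by apply/funext => n; rewrite /harmonic /= -[n.+2]addn1 natrD mulrDl mul1r divff// pnatr_eq0.
Qed.

Lemma locally_regular_powR (p : R) : 0 <= p ->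
  locally_regular (fun n => n%:R `^ (- p) : R).
Proof.
move=> p0; split.
- by near=> n; rewrite powR_gt0// ltr0n; near: n; exact: nbhs_infty_gt.
- have c : {for 1, continuous (fun a : R => a `^ (- p))}.
    apply: differentiable_continuous; apply/derivable1_diffP; apply: derivable_powR.
    by rewrite in_itv/= ltr01.
  have := cvg_comp _ _ cvg_ratio_nat c; rewrite powR1.
  apply: cvg_trans; apply: near_eq_cvg; near=> n.
  have n0 : 0 < n%:R `^ (- p) :> R.
    by rewrite powR_gt0// ltr0n; near: n; exact: nbhs_infty_gt.
  apply: (mulIf (lt0r_neq0 n0)); rewrite /= divfK ?gt_eqF//= -powRM//.
  by rewrite divfK// pnatr_eq0 -lt0n; near: n; exact: nbhs_infty_gt.
- exists (2 `^ p); near=> n => m /andP[nm mn].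
  have n0 : (0 < n)%N by near: n; exact: nbhs_infty_gt.
  have m0 : (0 < m)%N by exact: leq_trans nm.
  have nR : 0 < n%:R :> R by rewrite ltr0n.
  have mR : 0 < m%:R :> R by rewrite ltr0n.
  have nmp : n%:R `^ p <= m%:R `^ p :> R by rewrite ge0_ler_powR// ?nnegrE// ?ler_nat ?ltW.
  have mnp : m%:R `^ p <= 2 `^ p * n%:R `^ p :> R.
    by rewrite -powRM// ge0_ler_powR// ?nnegrE// -?natrM ?ler_nat//; lia.
  have n1 : 0 < n%:R `^ p :> R by rewrite powR_gt0.
  have m1 : 0 < m%:R `^ p :> R by rewrite powR_gt0.
  have p1 : 1 <= 2 `^ p :> R.
    have : 2 `^ 0 <= 2 `^ p :> R by rewrite ler_powR// ler1n.
    by rewrite powRr0.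
  rewrite !powRN; split.
    by rewrite ler_pdivlMr// mulrC ler_pdivrMr.
  rewrite ler_pdivlMr// mulrC ler_pdivrMr//.
  by apply: le_trans nmp _; rewrite ler_peMl// ltW.
Unshelve. all: by end_near. Qed.

Lemma locally_regular_slowly_varying (l : R -> R) : slowly_varying l ->
  locally_regular (fun n => l n%:R).
Proof.
move=> sl.
split.
- have [X [X0 XH]] := slowly_varying_doubling sl ltr01.
  near=> n; have Xn : X <= n%:R by near: n; exact: nbhs_infty_ger.
  by have [|] := XH n%:R n%:R Xn; lra.
- apply/cvgrPdist_le => e e0.
  have [X [X0 XH]] := slowly_varying_doubling sl e0.
  near=> n.
  have Xn : X <= n%:R by near: n; exact: nbhs_infty_ger.
  have n1 : 1 <= n%:R :> R by near: n; exact: nbhs_infty_ger.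
  have [|ln h1 h2] := XH n%:R n.+1%:R Xn.
    by rewrite -addn1 natrD; apply/andP; split; lra.
  set r := l n.+1%:R / l n%:R.
  have r1 : r <= 1 + e by rewrite ler_pdivrMr.
  have r2 : 1 <= r + e * r.
    by rewrite -[X in X + _]mul1r -mulrDl mulrA ler_pdivlMr// mul1r.
  have [r3|r3] := leP r 1.
    rewrite ger0_norm; last by lra.
    by have := ler_wpM2l (ltW e0) r3; lra.
  by rewrite ler0_norm; lra.
- have [X [X0 XH]] := slowly_varying_doubling sl ltr01.
  exists 2; near=> n => m /andP[nm mn].
  have Xn : X <= n%:R by near: n; exact: nbhs_infty_ger.
  have [|ln h1 h2] := XH n%:R m%:R Xn.
    by rewrite -natrM !ler_nat nm/=; lia.
  by split; lra.
Unshelve. all: by end_near. Qed.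

End regular_sequences.

(** * Power bounds and the convolution in the free case *)

Section growth.
Context {R : realType}.

Lemma le_powR_base (p x y : R) : 0 <= p -> 0 <= x -> x <= y -> x `^ p <= y `^ p.
Proof.
by move=> p0 x0 xy; apply: ge0_ler_powR => //; rewrite nnegrE//; exact: le_trans xy.
Qed.

(** Half of Potter's bounds: halving the argument k times to come back to
    [X, 2 X] costs a factor 2^(k p). *)
Lemma doubling_growth (f : R -> R) (X p : R) : 0 < X -> 0 < p ->
  (forall x, X <= x -> 0 <= f x) ->
  (forall x y, X <= x -> x <= y <= 2 * x -> f y <= 2 `^ p * f x) ->
  exists2 K, 0 < K & forall y, X <= y -> f y <= K * y `^ p.
Proof.
move=> X0 p0 f0 fd.
have Xp : 0 < X `^ p by rewrite powR_gt0.
have tp : 0 < 2 `^ p :> R by rewrite powR_gt0.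
pose K := 2 `^ p * f X / X `^ p.
have K0 : 0 <= K by rewrite /K divr_ge0 ?mulr_ge0 ?f0// ltW.
exists (K + 1); first by lra.
have base y : X <= y -> y <= 2 * X -> f y <= K * y `^ p.
  move=> Xy yX; apply: le_trans (fd X y (lexx _) _) _; first by rewrite Xy yX.
  rewrite /K mulrAC ler_pdivlMr//; apply: ler_wpM2l; first by rewrite mulr_ge0 ?f0// ltW.
  by apply: le_powR_base; lra.
suff H n : forall y, X <= y -> y <= 2 ^+ n * X -> f y <= K * y `^ p.
  move=> y Xy; apply: (@le_trans _ _ (K * y `^ p)); last first.
    by rewrite ler_wpM2r ?powR_ge0// lerDl.
  have [n _ nH] : \forall n \near \oo, y / X <= 2 ^+ n :> R.
    near=> n; apply: (@le_trans _ _ n%:R).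
      by near: n; exact: nbhs_infty_ger.
    by rewrite -natrX ler_nat ltnW// ltn_expl.
  apply: (H n) => //; rewrite -ler_pdivrMr//; exact: nH (leqnn n).
elim: n => [|n IH] y Xy; first by rewrite expr0 mul1r => yX; apply: base => //; lra.
move=> yX; have [y2X|y2X] := leP y (2 * X); first exact: base.
have h : f (y / 2) <= K * (y / 2) `^ p.
  by apply: IH; [lra|move: yX; rewrite exprS; lra].
apply: le_trans (fd (y / 2) y _ _) _; first by lra.
  by apply/andP; split; lra.
apply: le_trans (ler_wpM2l (ltW tp) h) _.
by rewrite mulrCA -powRM// ?(mulrC 2) ?divfK//; lra.
Unshelve. all: by end_near. Qed.

(** Both bounds come from [doubling_growth], applied to l and to its inverse. *)
Lemma slowly_varying_growth (l : R -> R) (p : R) : slowly_varying l -> 0 < p ->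
  exists2 K, 0 < K & \forall x \near +oo,
    [/\ 0 < l x, l x <= K * x `^ p & 1 <= K * x `^ p * l x].
Proof.
move=> sl p0.
have tp : 0 < 2 `^ p - 1 :> R.
  have : 1 `^ p < 2 `^ p :> R.
    by apply: gt0_ltr_powR; rewrite ?nnegrE// ltr1n.
  by rewrite powR1; lra.
have [X [X0 XH]] := slowly_varying_doubling sl tp.
have lpos x : X <= x -> 0 < l x.
  by move=> Xx; have [|] := XH x x Xx; lra.
have [||K1 K10 K1H] := @doubling_growth l X p X0 p0.
- by move=> x /lpos/ltW.
- by move=> x y Xx xy; have [_ + _] := XH x y Xx xy; rewrite subrKC.
have [||K2 K20 K2H] := @doubling_growth (fun x => (l x)^-1) X p X0 p0.
- by move=> x /lpos/ltW; rewrite invr_ge0.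
- move=> x y Xx xy; have [lx _] := XH x y Xx xy; rewrite subrKC => h.
  have ly : 0 < l y by apply: lpos; lra.
  by rewrite ler_pdivlMr// mulrC ler_pdivrMr.
exists (K1 + K2); first by lra.
near=> x.
have Xx : X <= x by near: x; apply: nbhs_pinfty_ge; exact: num_real.
have lx := lpos x Xx; split => //.
  by apply: le_trans (K1H x Xx) _; rewrite ler_wpM2r ?powR_ge0//; lra.
rewrite -ler_pdivrMr// mul1r.
by apply: le_trans (K2H x Xx) _; rewrite ler_wpM2r ?powR_ge0//; lra.
Unshelve. all: by end_near. Qed.

Lemma powR_nat_gt0 (p : R) (n : nat) : (0 < n)%N -> 0 < n%:R `^ p.
Proof. by move=> n0; rewrite powR_gt0// ltr0n. Qed.

Lemma near_bound_everywhere (f g : nat -> R) (K : R) : 0 <= K ->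
  (forall n, (0 < n)%N -> 0 < g n) ->
  (\forall n \near \oo, f n <= K * g n) ->
  exists2 K', 0 <= K' & forall n, (0 < n)%N -> f n <= K' * g n.
Proof.
move=> K0 g0 [n0 _ n0H].
have s0 : 0 <= \sum_(1 <= j < n0) `|f j| / g j.
  rewrite big_nat_cond; apply: sumr_ge0 => j /andP[/andP[j0 _] _].
  by rewrite divr_ge0// ltW// g0.
exists (K + \sum_(1 <= j < n0) `|f j| / g j); first by rewrite addr_ge0.
move=> n np; have gn := g0 n np.
have [nn0|n0n] := ltnP n n0; last first.
  by apply: le_trans (n0H n n0n) _; apply: ler_wpM2r; [exact: ltW|rewrite lerDl].
rewrite -ler_pdivrMr//; apply: (@le_trans _ _ (`|f n| / g n)).
  by rewrite ler_wpM2r ?ler_norm// invr_ge0 ltW.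
rewrite (bigD1_seq n)//= ?mem_index_iota ?iota_uniq ?np//.
rewrite addrCA lerDl addr_ge0// big_seq_cond; apply: sumr_ge0 => j.
by rewrite mem_index_iota => /andP[/andP[j0 _] _]; rewrite divr_ge0// ltW// g0.
Qed.

Lemma sum_inv_sqrt_le (N : nat) :
  \sum_(1 <= j < N.+1) (Num.sqrt j%:R)^-1 <= 2 * Num.sqrt N%:R :> R.
Proof.
elim: N => [|N IH]; first by rewrite big_geq// mulr_ge0 ?sqrtr_ge0.
rewrite big_nat_recr//=.
set s := Num.sqrt N%:R in IH *; set t := Num.sqrt N.+1%:R.
have s0 : 0 <= s by exact: sqrtr_ge0.
have t0 : 0 < t by rewrite sqrtr_gt0 ltr0n.
have st : s <= t by rewrite ler_sqrt ?ler_nat.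
have e : t * t - s * s = 1.
  by rewrite -!expr2 !sqr_sqrtr ?ler0n// -addn1 natrD; lra.
clearbody s t.
(* 1 = (t - s) * (t + s) and s <= t *)
have : t^-1 <= 2 * (t - s).
  rewrite -[leLHS]mul1r ler_pdivrMr//.
  have : 0 <= (t - s) * (t - s) by rewrite -expr2 sqr_ge0.
  lra.
lra.
Qed.

Lemma cvg_powRN0 (p : R) : 0 < p -> (N%:R : R) `^ (- p) @[N --> \oo] --> (0 : R).
Proof.
move=> p0; apply: cvg_near0 => e e0; near=> N.
rewrite ger0_norm ?powR_ge0// powRN.
have N0 : 0 < N%:R :> R by rewrite ltr0n; near: N; exact: nbhs_infty_gt.
rewrite -[leRHS]invrK lef_pV2 ?posrE ?powR_gt0 ?invr_gt0//.
have e1 : 0 <= e^-1 by rewrite invr_ge0 ltW.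
have -> : e^-1 = (e^-1 `^ p^-1) `^ p.
  by rewrite -powRrM mulVf ?powRr1// lt0r_neq0.
apply: le_powR_base; [exact: ltW|exact: powR_ge0|].
by near: N; exact: nbhs_infty_ger.
Unshelve. all: by end_near. Qed.

(** The exponents are those of a n = n^(-3/2) and b n = n^(-1/2) relaxed by
    h = 1/12 to absorb slowly varying factors: the sum is of order
    N^(-3/2+h) * N^(1/2+h), against N^(-1/2-h) for b N, and 3 h < 1/2. *)
Lemma tail_convolution (a b : nat -> R) (K : R) : 0 <= K ->
  (forall n, 0 <= a n) -> (forall n, 0 <= b n) ->
  (\forall n \near \oo, a n <= K * n%:R `^ (- (17 / 12))) ->
  (\forall n \near \oo, b n <= K * n%:R `^ (- (5 / 12))) ->
  (\forall n \near \oo, 1 <= K * n%:R `^ (7 / 12) * b n) ->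
  \sum_(0 <= j < N - N./2) b j * a (N - j)%N / b N @[N --> \oo] --> (0 : R).
Proof.
move=> K0 a0 b0 aK bK Kb.
have [Ka Ka0 {}aK] := near_bound_everywhere K0 (powR_nat_gt0 _) aK.
have [Kp Kp0 {}bK] := near_bound_everywhere K0 (powR_nat_gt0 _) bK.
have pw0 (N : nat) p : 0 <= N%:R `^ p :> R by exact: powR_ge0.
pose C := (b 0%N + 2 * Kp) * (Ka * 2 `^ (17 / 12)) * K.
have C0 : 0 <= C.
  by rewrite /C !mulr_ge0 ?addr_ge0 ?b0 ?mulr_ge0 ?powR_ge0.
have lim0 : C * (N%:R : R) `^ (- (1 / 4)) @[N --> \oo] --> (0 : R).
  by rewrite -(mulr0 C); apply: cvgM; [exact: cvg_cst|apply: cvg_powRN0; lra].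
apply: cvg_near0 => e e0.
have : \forall N \near \oo, C * (N%:R : R) `^ (- (1 / 4)) <= e.
  move/cvgrPdist_le : lim0 => /(_ _ e0); apply: filterS => N.
  by rewrite sub0r normrN; apply: le_trans; exact: ler_norm.
move=> CN; near=> N.
have N0 : (0 < N)%N by near: N; exact: nbhs_infty_gt.
have NR : 0 < N%:R :> R by rewrite ltr0n.
have N1 : 1 <= N%:R :> R by rewrite ler1n.
have NKb : 1 <= K * N%:R `^ (7 / 12) * b N by near: N.
have bN : 0 < b N.
  rewrite lt_neqAle b0 andbT; apply/eqP => bN0; move: NKb.
  by rewrite -bN0 mulr0; lra.
apply: le_trans (_ : C * N%:R `^ (- (1 / 4)) <= _); last by near: N.
rewrite ger0_norm; last by apply: sumr_ge0 => j _; rewrite divr_ge0 ?mulr_ge0.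
have aN j : (j < N - N./2)%N -> a (N - j)%N <= Ka * 2 `^ (17 / 12) * N%:R `^ (- (17 / 12)).
  move=> jN; apply: le_trans (aK _ _) _; first by lia.
  rewrite -mulrA ler_wpM2l// !powRN.
  rewrite ler_pdivlMr ?powR_gt0// mulrC ler_pdivrMr ?powR_gt0 ?ltr0n//; last by lia.
  rewrite -powRM//; apply: le_powR_base => //; last by rewrite -natrM ler_nat; lia.
have bS : \sum_(0 <= j < N - N./2) b j <= (b 0%N + 2 * Kp) * N%:R `^ (7 / 12).
  have NN : (N - N./2 <= N.+1)%N by lia.
  apply: (@le_trans _ _ (\sum_(0 <= j < N.+1) b j)).
    by rewrite [leRHS](big_cat_nat (leq0n _) NN)/= lerDl sumr_ge0.
  rewrite big_ltn// mulrDl; apply: lerD.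
    rewrite ler_peMr//.
    have : N%:R `^ 0 <= N%:R `^ (7 / 12) :> R by rewrite ler_powR//; lra.
    by rewrite powRr0.
  apply: (@le_trans _ _ (\sum_(1 <= j < N.+1) Kp * N%:R `^ (1 / 12) * (Num.sqrt j%:R)^-1)).
    rewrite big_nat_cond [leRHS]big_nat_cond; apply: ler_sum => j /andP[/andP[j0 jN] _].
    apply: le_trans (bK j j0) _; rewrite -mulrA ler_wpM2l//.
    have jR : 0 < j%:R :> R by rewrite ltr0n.
    (* j^(-5/12) = j^(1/12) * j^(-1/2), and j <= N *)
    rewrite -powR12_sqrt ?(ltW jR)// -powRN (_ : - (5 / 12) = 1 / 12 + - 2^-1); last by field.
    rewrite (@powRD _ j%:R (1 / 12)); last by apply/implyP => _; rewrite gt_eqF.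
    by apply: ler_wpM2r; rewrite ?powR_ge0//; apply: le_powR_base => //; rewrite ler_nat.
  rewrite -mulr_sumr.
  apply: le_trans (ler_wpM2l _ (sum_inv_sqrt_le N)) _; first by rewrite mulr_ge0.
  rewrite (_ : 7 / 12 = 1 / 12 + 2^-1); last by field.
  rewrite powRD; last by apply/implyP => _; rewrite gt_eqF.
  by rewrite powR12_sqrt ?(ltW NR)//; lra.
apply: (@le_trans _ _ (((b 0%N + 2 * Kp) * N%:R `^ (7 / 12)) *
   (Ka * 2 `^ (17 / 12) * N%:R `^ (- (17 / 12))) * (K * N%:R `^ (7 / 12)))).
  rewrite -mulr_suml; apply: ler_pM.
  - by apply: sumr_ge0 => j _; rewrite mulr_ge0.
  - by rewrite invr_ge0.
  - apply: (@le_trans _ _ ((\sum_(0 <= j < N - N./2) b j) *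
        (Ka * 2 `^ (17 / 12) * N%:R `^ (- (17 / 12))))).
      rewrite mulr_suml big_nat_cond [leRHS]big_nat_cond.
      apply: ler_sum => j /andP[/andP[_ jN] _].
      by apply: ler_wpM2l => //; exact: aN.
    by apply: ler_wpM2r => //; rewrite !mulr_ge0 ?powR_ge0.
  - by rewrite -[leLHS]mul1r ler_pdivrMr.
rewrite le_eqVlt; apply/orP; left; apply/eqP; rewrite /C.
have -> : - (1 / 4) = (7 / 12 + 7 / 12) + - (17 / 12) :> R by field.
rewrite !(@powRD _ N%:R); try by apply/implyP => _; rewrite gt_eqF.
by ring.
Unshelve. all: by end_near. Qed.

(** The half of the convolution near a 0 carries the limit, by
    [half_convolution]; the other half is [tail_convolution]. *)
Lemma convolution_asymp (a b : nat -> R) (A K : R) : 0 <= K ->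
  (forall n, 0 <= a n) -> (forall n, 0 <= b n) ->
  series a @ \oo --> A -> locally_regular b ->
  (\forall n \near \oo, a n <= K * n%:R `^ (- (17 / 12))) ->
  (\forall n \near \oo, b n <= K * n%:R `^ (- (5 / 12))) ->
  (\forall n \near \oo, 1 <= K * n%:R `^ (7 / 12) * b n) ->
  (\sum_(0 <= k < N.+1) a k * b (N - k)%N) / b N @[N --> \oo] --> A.
Proof.
move=> K0 a0 b0 aA rb aK bK Kb.
have h N : (N./2 <= N./2.+1 <= N./2.+1)%N by rewrite leqnSn leqnn.
apply: (@cvg_trans _ ((fun N => \sum_(0 <= k < N./2.+1) a k * (b (N - k)%N / b N) +
    \sum_(0 <= j < N - N./2) b j * a (N - j)%N / b N) @ \oo)); last first.
  rewrite -[A]addr0; apply: cvgD; first exact: half_convolution.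
  exact: tail_convolution K0 a0 b0 aK bK Kb.
apply: near_eq_cvg; near=> N.
have hN : (N./2.+1 <= N.+1)%N by lia.
rewrite [in RHS](big_cat_nat (leq0n _) hN)/= mulrDl; congr (_ + _).
  by rewrite mulr_suml; apply: eq_bigr => k _; rewrite mulrA.
rewrite -{1}[N./2.+1]add0n big_addn subSS big_nat_rev/= mulr_suml.
rewrite [LHS]big_nat_cond [RHS]big_nat_cond.
apply: eq_bigr => k /andP[/andP[_ kn] _].
rewrite [a _ * _]mulrC; congr (b _ * a _ / _); lia.
Unshelve. all: by end_near. Qed.

End growth.

(** * Asymptotics of the two partition functions, as sequences *)

Section asymptotics_of_renewal.
Context {R : realType}.

Lemma locally_regular_cst (c : R) : 0 < c -> locally_regular (fun=> c).
Proof.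
move=> c0; split; first by near=> n.
- by rewrite divff ?gt_eqF//; exact: cvg_cst.
- by exists 1; near=> n => m _; rewrite mul1r.
Unshelve. all: by end_near. Qed.

Lemma slowly_varying_nat_growth (l : R -> R) (p : R) : slowly_varying l -> 0 < p ->
  exists2 K, 0 < K & \forall n \near \oo,
    [/\ 0 < l n%:R, l n%:R <= K * n%:R `^ p & 1 <= K * n%:R `^ p * l n%:R].
Proof.
move=> sl p0; have [K K0 [M [_ MH]]] := slowly_varying_growth sl p0.
exists K => //; near=> n; apply: MH.
by near: n; exact: nbhs_infty_gtr.
Unshelve. all: by end_near. Qed.

Variables (L : R -> R) (q u : nat -> R) (c delta : R).
Hypotheses (L_sv : slowly_varying L) (c0 : 0 < c) (delta0 : 0 < delta) (delta1 : delta < 1).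
Hypotheses (q0 : q 0%N = 0) (q_ge0 : forall n, 0 <= q n).
Hypothesis q1 : series q @ \oo --> (1 : R).
Hypothesis q_asymp : asymp_equiv \oo q (fun n => c * L n%:R * n%:R `^ (- (3 / 2))).
Hypothesis u0 : u 0%N = 1.
Hypothesis uS : forall N, (0 < N)%N ->
  u N = delta * \sum_(0 <= k < N.+1) q k * u (N - k)%N.

Lemma locally_regular_return : locally_regular q.
Proof.
apply: locally_regular_equiv q_asymp.
apply: locally_regularM; last by apply: locally_regular_powR; lra.
apply: locally_regularM; first exact: locally_regular_cst.
exact: locally_regular_slowly_varying.
Qed.

Lemma constrained_asymp : asymp_equiv \oo u
  (fun N => delta * c / (1 - delta) ^+ 2 * (L N%:R / N%:R `^ (3 / 2))).
Proof.
have uq := renewal_asymp delta0 delta1 q0 q_ge0 q1 u0 uS locally_regular_return.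
have [qpos _ _] := locally_regular_return.
have [K _ LK] := slowly_varying_nat_growth L_sv (ltr01 : 0 < 1 :> R).
have d0 : delta != 0 by rewrite gt_eqF.
have d1 : 1 - delta != 0 by rewrite gt_eqF// subr_gt0.
rewrite /asymp_equiv /=.
have lim : (u N / q N) * (q N / (c * L N%:R * N%:R `^ (- (3 / 2)))) *
    ((1 - delta) ^+ 2 / delta) @[N --> \oo] -->
    (delta / (1 - delta) ^+ 2 * 1 * ((1 - delta) ^+ 2 / delta)).
  by apply: cvgM; [exact: cvgM uq q_asymp|exact: cvg_cst].
have lim1 : delta / (1 - delta) ^+ 2 * 1 * ((1 - delta) ^+ 2 / delta) = 1.
  by field; rewrite d0 d1.
rewrite lim1 in lim.
apply: cvg_trans lim; apply: near_eq_cvg; near=> N.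
have qN : q N != 0 by rewrite gt_eqF//; near: N.
have [LN _ _] : [/\ 0 < L N%:R, L N%:R <= K * N%:R `^ 1 & 1 <= K * N%:R `^ 1 * L N%:R].
  by near: N.
have N0 : N%:R `^ (3 / 2) != 0 :> R.
  by rewrite gt_eqF// powR_gt0// ltr0n; near: N; exact: nbhs_infty_gt.
rewrite powRN; field.
by rewrite d0 d1 qN N0 (gt_eqF c0) (gt_eqF LN).
Unshelve. all: by end_near. Qed.

Variables (p L' : nat -> R).
Hypothesis p_ge0 : forall n, 0 <= p n.
Hypothesis L'E : forall n, L' n = Num.sqrt n%:R * p n.
Hypothesis L'_sv : slowly_varying_seq L'.

Lemma tail_powR n : (0 < n)%N -> p n = L' n * n%:R `^ (- (1 / 2)).
Proof.
move=> n0; rewrite powRN div1r powR12_sqrt// L'E mulrAC divff ?mul1r//.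
by rewrite gt_eqF// sqrtr_gt0 ltr0n.
Qed.

Lemma locally_regular_tail : locally_regular p.
Proof.
have := locally_regularM (locally_regular_slowly_varying L'_sv)
  (@locally_regular_powR R (1 / 2) ltac:(lra)).
under [X in locally_regular X]eq_fun do rewrite natrK.
move=> /[dup] -[b0 _ _] H; apply: locally_regular_equiv H _.
rewrite /asymp_equiv; apply: cvg_near_cst; near=> n.
have n0 : (0 < n)%N by near: n; exact: nbhs_infty_gt.
by rewrite tail_powR// divff// gt_eqF//; near: n.
Unshelve. all: by end_near. Qed.

(** [convolution_asymp] with mass (1 - delta)^-1. Its power bounds hold because
    u is of order n^(-3/2) and p of order n^(-1/2), up to the slowly varying L
    and L', which n^(1/12) absorbs. *)
Lemma free_asymp : asymp_equiv \oo (fun N => \sum_(0 <= k < N.+1) u k * p (N - k)%N)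
  (fun N => 1 / (1 - delta) * (L' N / N%:R `^ (1 / 2))).
Proof.
have uge := renewal_ge0 delta0 delta1 q0 q_ge0 u0 uS.
have usum := renewal_sum delta0 delta1 q0 q_ge0 q1 u0 uS.
have h0 : 0 < 1 / 12 :> R by lra.
have [K1 K10 LK] := slowly_varying_nat_growth L_sv h0.
have [K2 K20 L'K] := slowly_varying_nat_growth L'_sv h0.
have [ppos _ _] := locally_regular_tail.
pose C := delta * c / (1 - delta) ^+ 2.
have C0 : 0 <= C.
  by rewrite /C divr_ge0 ?sqr_ge0// mulr_ge0// ltW.
have uL : \forall n \near \oo, u n <= 2 * (C * (L n%:R / n%:R `^ (3 / 2))).
  move/cvgrPdist_le : constrained_asymp => /(_ 1 ltr01); rewrite -/C => H.
  near=> n.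
  have [Ln _ _] : [/\ 0 < L n%:R, L n%:R <= K1 * n%:R `^ (1 / 12) &
    1 <= K1 * n%:R `^ (1 / 12) * L n%:R] by near: n.
  have n0 : 0 < n%:R :> R by rewrite ltr0n; near: n; exact: nbhs_infty_gt.
  have Cp : 0 < C * (L n%:R / n%:R `^ (3 / 2)).
    have d1 : 0 < 1 - delta by rewrite subr_gt0.
    by rewrite /C !mulr_gt0 ?invr_gt0 ?exprn_gt0 ?powR_gt0.
  have : `|1 - u n / (C * (L n%:R / n%:R `^ (3 / 2)))| <= 1 by near: n.
  rewrite ler_norml => /andP[h1 _]; rewrite -ler_pdivrMr//; lra.
clearbody C.
have K1ge0 := ltW K10; have K2ge0 := ltW K20.
have CK0 : 0 <= 2 * C * K1 by rewrite !mulr_ge0.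
have K0 : 0 <= 2 * C * K1 + K2 by rewrite addr_ge0.
have K2K : K2 <= 2 * C * K1 + K2 by rewrite lerDr.
have K1K : 2 * C * K1 <= 2 * C * K1 + K2 by rewrite lerDl.
have lim : (\sum_(0 <= k < N.+1) u k * p (N - k)%N) / p N @[N --> \oo] --> (1 - delta)^-1.
  apply: (convolution_asymp K0 uge p_ge0 usum locally_regular_tail).
  - near=> n.
    have [Ln LnK _] : [/\ 0 < L n%:R, L n%:R <= K1 * n%:R `^ (1 / 12) &
      1 <= K1 * n%:R `^ (1 / 12) * L n%:R] by near: n.
    have n0 : 0 < n%:R :> R by rewrite ltr0n; near: n; exact: nbhs_infty_gt.
    have un : u n <= 2 * (C * (L n%:R / n%:R `^ (3 / 2))) by near: n.
    apply: (le_trans un).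
    apply: (@le_trans _ _ (2 * C * K1 * n%:R `^ (- (17 / 12)))); last first.
      by apply: ler_wpM2r => //; exact: powR_ge0.
    rewrite (_ : - (17 / 12) = 1 / 12 + - (3 / 2) :> R); last by field.
    rewrite (@powRD _ n%:R); last by apply/implyP => _; rewrite gt_eqF.
    rewrite powRN mulrA -[leRHS]mulrA; apply: ler_wpM2l; first by rewrite mulr_ge0.
    by rewrite mulrA ler_wpM2r// invr_ge0 powR_ge0.
  - near=> n.
    have [_ LnK _] : [/\ 0 < L' (Num.truncn (n%:R : R)),
        L' (Num.truncn (n%:R : R)) <= K2 * n%:R `^ (1 / 12) &
        1 <= K2 * n%:R `^ (1 / 12) * L' (Num.truncn (n%:R : R))] by near: n.
    have n0 : (0 < n)%N by near: n; exact: nbhs_infty_gt.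
    have nR : 0 < n%:R :> R by rewrite ltr0n.
    rewrite natrK in LnK.
    apply: (@le_trans _ _ (K2 * n%:R `^ (- (5 / 12)))); last first.
      by apply: ler_wpM2r => //; exact: powR_ge0.
    rewrite tail_powR// (_ : - (5 / 12) = 1 / 12 + - (1 / 2) :> R); last by field.
    rewrite (@powRD _ n%:R); last by apply/implyP => _; rewrite gt_eqF.
    by rewrite mulrA; apply: ler_wpM2r => //; exact: powR_ge0.
  - near=> n.
    have [_ _ LnK] : [/\ 0 < L' (Num.truncn (n%:R : R)),
        L' (Num.truncn (n%:R : R)) <= K2 * n%:R `^ (1 / 12) &
        1 <= K2 * n%:R `^ (1 / 12) * L' (Num.truncn (n%:R : R))] by near: n.
    have nR : 0 < n%:R :> R by rewrite ltr0n; near: n; exact: nbhs_infty_gt.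
    rewrite natrK L'E in LnK; apply: (le_trans LnK).
    rewrite (_ : 7 / 12 = 1 / 12 + 2^-1 :> R); last by field.
    rewrite (@powRD _ n%:R); last by apply/implyP => _; rewrite gt_eqF.
    rewrite powR12_sqrt ?(ltW nR)// !mulrA; apply: ler_wpM2r => //.
    apply: ler_wpM2r; first exact: sqrtr_ge0.
    by apply: ler_wpM2r => //; exact: powR_ge0.
have d1 : 1 - delta != 0 by rewrite gt_eqF// subr_gt0.
have {}lim : (\sum_(0 <= k < N.+1) u k * p (N - k)%N) / p N * (1 - delta)
    @[N --> \oo] --> (1 - delta)^-1 * (1 - delta).
  by apply: cvgM lim _; exact: cvg_cst.
rewrite mulVf// in lim; apply: cvg_trans lim; apply: near_eq_cvg; near=> N.
have n0 : (0 < N)%N by near: N; exact: nbhs_infty_gt.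
have pN : p N != 0 by rewrite gt_eqF//; near: N.
have -> : L' N / N%:R `^ (1 / 2) = p N by rewrite -powRN -tail_powR.
by field; rewrite pN d1.
Unshelve. all: by end_near. Qed.

End asymptotics_of_renewal.

(** * Transfer operators and decompositions of paths *)

Section transfer.
Context {R : realType}.
Local Open Scope ereal_scope.
Variable mu : {sigma_finite_measure set (measurableTypeR R) -> \bar R}.
Variable w : measurableTypeR R -> \bar R.
Hypothesis mw : measurable_fun setT w.
Hypothesis w0 : forall x, 0 <= w x.
Implicit Types g : measurableTypeR R -> \bar R.

Definition nonneg_measurable (g : measurableTypeR R -> \bar R) :=
  measurable_fun setT g /\ forall x, 0 <= g x.

(** The transfer operators of one step of the chain, with weight w on the
    increment, for the reference measure on ]0, +oo[ and for the pinning measure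
    with its atom eps at 0. A partition function over N sites is an N-fold
    iterate evaluated at the starting point 0. *)
Definition killed_step g (x : measurableTypeR R) : \bar R :=
  \int[mu]_(y in `]0%R, +oo[) (w (y - x)%R * g y).

Definition pinned_step (eps : R) g (x : measurableTypeR R) : \bar R :=
  killed_step g x + eps%:E * (w (- x)%R * g 0%R).

Lemma killed_stepE g x :
  killed_step g x = \int[mu]_y ((\1_(`]0%R, +oo[%classic : set R) y)%:E * (w (y - x)%R * g y)).
Proof.
rewrite /killed_step integral_mkcond; apply: eq_integral => y _.
by rewrite epatch_indic muleC.
Qed.

Lemma measurable_kernel_prod g : measurable_fun setT g ->
  measurable_fun setT (fun z : measurableTypeR R * measurableTypeR R =>
    (\1_(`]0%R, +oo[%classic : set R) z.2)%:E * (w (z.2 - z.1)%R * g z.2)).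
Proof.
move=> mg; apply: emeasurable_funM.
  apply/measurable_EFinP.
  have h : measurable_fun setT
    (\1_(`]0%R, +oo[%classic : set (measurableTypeR R)) : measurableTypeR R -> R).
    by apply: measurable_indic; exact: measurable_itv.
  exact: (measurableT_comp h measurable_snd).
apply: emeasurable_funM.
  apply: (measurableT_comp mw); apply: measurable_funB.
    exact: measurable_snd.
  exact: measurable_fst.
exact: measurableT_comp.
Qed.

Lemma nonneg_measurable_killed g : nonneg_measurable g -> nonneg_measurable (killed_step g).
Proof.
move=> [mg g0]; split; last first.
  by move=> x; apply: integral_ge0 => y _; rewrite mule_ge0.
have F0 (z : measurableTypeR R * measurableTypeR R) : 0 <=
    (\1_(`]0%R, +oo[%classic : set R) z.2)%:E * (w (z.2 - z.1)%R * g z.2).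
  by rewrite mule_ge0 ?lee_fin// mule_ge0.
have := measurable_fun_fubini_tonelli_F (m2 := mu) _ (measurable_kernel_prod mg) F0.
by rewrite (_ : fubini_F _ _ = killed_step g)//; apply/funext => x; rewrite killed_stepE.
Qed.

(** Extended coefficients c are allowed, so that no finiteness of partition
    functions is required to decompose them. *)
Definition nonneg_linear (op : (measurableTypeR R -> \bar R) -> measurableTypeR R -> \bar R) :=
  (forall g, nonneg_measurable g -> nonneg_measurable (op g)) /\
  forall f g c, nonneg_measurable f -> nonneg_measurable g -> 0 <= c ->
    forall x, op (fun y => f y + c * g y) x = op f x + c * op g x.

Lemma nonneg_measurableD f g c : nonneg_measurable f -> nonneg_measurable g -> 0 <= c ->
  nonneg_measurable (fun y => f y + c * g y).
Proof.
move=> [mf f0] [mg g0] c0; split.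
  by apply: emeasurable_funD => //; exact: measurable_funeM.
by move=> x; rewrite adde_ge0// mule_ge0.
Qed.

Lemma nonneg_measurable_weight : nonneg_measurable (fun x => w (- x)%R).
Proof.
split => //; apply: (measurableT_comp mw).
exact: measurable_funN.
Qed.

Lemma measurable_shifted_weight (x : measurableTypeR R) :
  measurable_fun setT (fun y : measurableTypeR R => w (y - x)%R).
Proof. by apply: (measurableT_comp mw); exact: measurable_funB. Qed.

Lemma nonneg_linear_killed : nonneg_linear killed_step.
Proof.
split; first exact: nonneg_measurable_killed.
move=> f g c [mf f0] [mg g0] c0 x.
have mwx := measurable_shifted_weight x.
rewrite /killed_step.
under eq_integral => y _ do rewrite ge0_muleDr ?mule_ge0// muleCA.
rewrite ge0_integralD//; last 4 first.
- by move=> y _; rewrite mule_ge0.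
- by apply: measurable_funTS; exact: emeasurable_funM.
- by move=> y _; rewrite !mule_ge0.
- by apply: measurable_funTS; apply: measurable_funeM; exact: emeasurable_funM.
congr (_ + _); rewrite ge0_integralZl//.
- by apply: measurable_funTS; exact: emeasurable_funM.
- by move=> y _; rewrite mule_ge0.
Qed.

Lemma nonneg_linear_pinned (eps : R) : (0 <= eps)%R -> nonneg_linear (pinned_step eps).
Proof.
move=> eps0; have [A0 AL] := nonneg_linear_killed; split.
  move=> g mg; rewrite /pinned_step.
  under eq_fun do rewrite [w _ * _]muleC muleA.
  apply: nonneg_measurableD; [exact: A0|exact: nonneg_measurable_weight|].
  by rewrite mule_ge0 ?lee_fin//; case: mg.
move=> f g c mf mg c0 x; rewrite /pinned_step AL//.
have [_ f0] := mf; have [_ g0] := mg; have [_ Af0] := A0 _ mf; have [_ Ag0] := A0 _ mg.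
move: (Af0 x) (Ag0 x) (f0 0%R) (g0 0%R) (w0 (- x)%R).
move: (killed_step f x) (killed_step g x) (f _) (g _) (w _) => a b f' g' w' a0 b0 f'0 g'0 w'0.
rewrite !ge0_muleDr ?mule_ge0 ?lee_fin//.
rewrite addeACA; congr (_ + (_ + _)).
by rewrite [in RHS]muleCA; congr (_ * _); rewrite muleCA.
Qed.

Lemma nonneg_measurable_iter op n g : nonneg_linear op -> nonneg_measurable g ->
  nonneg_measurable (iter n op g).
Proof. by move=> [H _] mg; elim: n => [|n IH] //=; exact: H. Qed.

Lemma nonneg_linear_sum op f (c : nat -> \bar R) (h : nat -> measurableTypeR R -> \bar R) n :
  nonneg_linear op -> nonneg_measurable f -> (forall k, 0 <= c k) ->
  (forall k, nonneg_measurable (h k)) ->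
  nonneg_measurable (fun y => f y + \sum_(0 <= k < n) c k * h k y) /\
  forall x, op (fun y => f y + \sum_(0 <= k < n) c k * h k y) x =
    op f x + \sum_(0 <= k < n) c k * op (h k) x.
Proof.
move=> opL mf c0 mh; elim: n => [|n [IH1 IH2]].
  under eq_fun do rewrite big_geq// adde0.
  by split => // x; rewrite big_geq// adde0.
under eq_fun do rewrite big_nat_recr//= addeA.
split; first exact: nonneg_measurableD.
by move=> x; rewrite opL.2// IH2 big_nat_recr//= addeA.
Qed.

(** Decomposition at the first visit to 0: in T = A + eps (jump to 0), with A the
    killed step, the iterate of T is expanded from the left until the first
    jump. *)
Lemma first_zero (eps : R) N g x : (0 <= eps)%R -> nonneg_measurable g ->
  iter N (pinned_step eps) g x = iter N killed_step g x +
    \sum_(0 <= k < N) (eps%:E * iter (N - k.+1) (pinned_step eps) g 0%R) *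
      iter k killed_step (fun y => w (- y)%R) x.
Proof.
move=> eps0 mg; have AL := nonneg_linear_killed; have TL := nonneg_linear_pinned eps0.
elim: N x => [|N IH] x; first by rewrite big_geq// adde0.
rewrite iterS {1}/pinned_step.
rewrite (_ : killed_step _ _ = killed_step (fun y => iter N killed_step g y +
    \sum_(0 <= k < N) (eps%:E * iter (N - k.+1) (pinned_step eps) g 0%R) *
      iter k killed_step (fun y => w (- y)%R) y) x); last first.
  by congr (killed_step _ _); apply/funext.
have c0 k : 0 <= eps%:E * iter (N - k.+1) (pinned_step eps) g 0%R.
  by rewrite mule_ge0 ?lee_fin//; apply: (nonneg_measurable_iter _ TL mg).2.
rewrite (nonneg_linear_sum N AL (nonneg_measurable_iter _ AL mg) c0 (fun k =>
  nonneg_measurable_iter k AL nonneg_measurable_weight)).2.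
rewrite -addeA; congr (_ + _).
rewrite [RHS]big_nat_recl//= subn1/= addeC; congr (_ + _).
by rewrite [w _ * _]muleC muleA.
Qed.

(** Decomposition at the last visit to 0, expanding from the right. *)
Lemma last_zero (eps : R) N g x : (0 <= eps)%R -> nonneg_measurable g ->
  iter N (pinned_step eps) g x = iter N killed_step g x +
    \sum_(0 <= k < N) (eps%:E * iter (N - k.+1) killed_step g 0%R) *
      iter k (pinned_step eps) (fun y => w (- y)%R) x.
Proof.
move=> eps0 mg; have AL := nonneg_linear_killed; have TL := nonneg_linear_pinned eps0.
elim: N x => [|N IH] x; first by rewrite big_geq// adde0.
rewrite iterS.
rewrite (_ : pinned_step _ _ _ = pinned_step eps (fun y => iter N killed_step g y +
    \sum_(0 <= k < N) (eps%:E * iter (N - k.+1) killed_step g 0%R) *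
      iter k (pinned_step eps) (fun y => w (- y)%R) y) x); last first.
  by congr (pinned_step _ _ _); apply/funext.
have c0 k : 0 <= eps%:E * iter (N - k.+1) killed_step g 0%R.
  by rewrite mule_ge0 ?lee_fin//; apply: (nonneg_measurable_iter _ AL mg).2.
rewrite (nonneg_linear_sum N TL (nonneg_measurable_iter _ AL mg) c0 (fun k =>
  nonneg_measurable_iter k TL nonneg_measurable_weight)).2.
rewrite [RHS]/= {1}/pinned_step -addeA; congr (_ + _).
rewrite [RHS]big_nat_recl//= subn1/=; congr (_ + _).
by rewrite [w _ * _]muleC muleA.
Qed.

End transfer.

(** * The reference measure and its lattice *)

Section integral_null.
Context d (T : measurableType d) (R : realType).
Variable mu : {measure set T -> \bar R}.
Local Open Scope ereal_scope.
Import HBNNSimple.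

Let sup_le (S : set T) (F G : T -> \bar R) : measurable S -> mu (~` S) = 0 ->
  (forall x, 0 <= G x) -> (forall x, S x -> F x = G x) ->
  ereal_sup [set sintegral mu h | h in
    [set h : {nnsfun T >-> R} | forall x, (h x)%:E <= F x]] <=
  ereal_sup [set sintegral mu h | h in
    [set h : {nnsfun T >-> R} | forall x, (h x)%:E <= G x]].
Proof.
move=> mS S0 G0 FG; apply: ge_ereal_sup => _ [h hF <-].
pose hS := mul_nnsfun h (indic_nnsfun R mS).
have hSE x : hS x = (h x * \1_S x)%R by [].
apply: ereal_sup_ubound; exists hS.
  move=> x; rewrite /mkset hSE indicE; case: (boolP (x \in S)) => xS.
    by rewrite mulr1 -FG//; exact: set_mem.
  by rewrite mulr0.
rewrite -!integralT_nnsfun; apply: ae_eq_integral => //.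
- exact/measurable_EFinP.
- exact/measurable_EFinP.
- exists (~` S); split => //; first exact: measurableC.
  move=> x h1 Sx; apply: h1 => _.
  by rewrite hSE indicE mem_set// mulr1.
Qed.

(** No measurability of f and g is assumed, because in the discrete set-up the
    potential is arbitrary off the integers. It suffices to compare the simple
    functions below f and g, after cutting them down to S. *)
Lemma eq_integral_null (S D : set T) (f g : T -> \bar R) :
  measurable S -> mu (~` S) = 0 ->
  (forall x, D x -> 0 <= f x) -> (forall x, D x -> 0 <= g x) ->
  (forall x, S x -> D x -> f x = g x) ->
  \int[mu]_(x in D) f x = \int[mu]_(x in D) g x.
Proof.
move=> mS S0 f0 g0 fg.
have f0' x : 0 <= (f \_ D) x by exact: erestrict_ge0.
have g0' x : 0 <= (g \_ D) x by exact: erestrict_ge0.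
have fg' x : S x -> (f \_ D) x = (g \_ D) x.
  by move=> Sx; rewrite !patchE; case: ifPn => // /set_mem; exact: fg.
rewrite !ge0_integralE//; apply/eqP; rewrite eq_le.
apply/andP; split; apply: sup_le mS S0 _ _ => //.
by move=> x Sx; rewrite fg'.
Qed.

End integral_null.

Lemma ge0_integral_mrestr d (T : measurableType d) (R : realType)
    (m : {measure set T -> \bar R}) (D : set T) (mD : measurable D)
    (f : T -> \bar R) : (forall x, 0 <= f x)%E ->
  (\int[mrestr m mD]_x f x = \int[m]_(x in D) f x)%E.
Proof.
move=> f0; transitivity (\int[mrestr m mD]_(x in D) f x)%E.
  rewrite [RHS]integral_mkcond; apply: (eq_integral_null mD).
  - by rewrite /= /mrestr setICl measure0.
  - by [].
  - by move=> x _; exact: erestrict_ge0.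
  - by move=> x Dx _; rewrite patchE mem_set.
apply: eq_measure_integral => A mA AD.
by rewrite /= /mrestr setIidl.
Qed.

Section reference.
Context {R : realType}.
Local Open Scope ereal_scope.

(** The additive group that carries the reference measure. *)
Definition lattice (s : setup) : set (measurableTypeR R) :=
  match s with
  | ContinuousSetup => setT
  | DiscreteSetup => range (fun z : int => z%:~R : measurableTypeR R)
  end.

Lemma measurable_lattice s : measurable (lattice s).
Proof. by case: s => //=; exact: measurable_range_intr. Qed.

Lemma lattice_full s : refmeas s (~` lattice s) = 0.
Proof.
case: s => /=; first by rewrite setCT measure0.
by rewrite /mrestr setICl measure0.
Qed.

Lemma lattice0 s : lattice s 0%R.
Proof. by case: s => //=; exists 0%R. Qed.

Lemma latticeB s x y : lattice s x -> lattice s y -> lattice s (x - y)%R.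
Proof.
case: s => //= -[k _ <-] [l _ <-]; exists (k - l)%R => //.
by rewrite intrD intrN.
Qed.

Lemma latticeD s x y : lattice s x -> lattice s y -> lattice s (x + y)%R.
Proof.
case: s => //= -[k _ <-] [l _ <-]; exists (k + l)%R => //.
by rewrite intrD.
Qed.

(** A copy of [refmeas] that carries a sigma-finite structure, for Fubini. *)
Definition sf_refmeas (s : setup) : set (measurableTypeR R) -> \bar R := refmeas s.

HB.instance Definition _ s := isMeasure.Build _ _ _ (sf_refmeas s)
  (measure0 (refmeas s)) (measure_ge0 (refmeas s))
  (@measure_semi_sigma_additive _ _ _ (refmeas s)).

Let sigma_finite_refmeas s : sigma_finite setT (sf_refmeas s).
Proof.
case: s; first exact: sigma_finiteT.
(* Each piece has at most one integer, and all non-integers, of measure 0 *)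
pose F (n : nat) : set (measurableTypeR R) :=
  ~` lattice DiscreteSetup `|`
  (if @unpickle int n is Some z then [set z%:~R : measurableTypeR R] else set0).
have mF1 n : measurable (if @unpickle int n is Some z then
    [set z%:~R : measurableTypeR R] else set0).
  by case: (@unpickle int n) => // z; exact: measurable_set1.
exists F.
  apply/seteqP; split => // x _.
  have [[z _ <-]|nx] := pselect (lattice DiscreteSetup x); last by exists 0%N => //; left.
  by exists (pickle z) => //; right; rewrite pickleK.
move=> n; split.
  by apply: measurableU => //; apply: measurableC; exact: (measurable_lattice DiscreteSetup).
have : refmeas DiscreteSetup (F n) <= refmeas DiscreteSetup (~` lattice DiscreteSetup) +
  refmeas DiscreteSetup (if @unpickle int n is Some z then
    [set z%:~R : measurableTypeR R] else set0).
  apply: measureU2 => //; apply: measurableC; exact: (measurable_lattice DiscreteSetup).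
move/le_lt_trans; apply.
rewrite (lattice_full DiscreteSetup) add0e.
set G := (X in refmeas _ X).
change (counting (G `&` lattice DiscreteSetup) < +oo :> \bar R).
rewrite /counting asboolT ?ltry//.
apply: finite_setIl; rewrite /G; case: (@unpickle int n) => // z; exact: finite_set1.
Qed.

HB.instance Definition _ s := Measure_isSigmaFinite.Build _ _ _ (sf_refmeas s)
  (sigma_finite_refmeas s).

Lemma counting_translation (c : R) (A : set R) :
  counting ((fun x => c + x)%R @` A) = counting A :> \bar R.
Proof.
have inj : injective (fun x : R => c + x)%R by exact: addrI.
have [fA|nfA] := pselect (finite_set A); last first.
  rewrite /counting !asboolF//.
  move=> fcA; apply: nfA.
  have := finite_image (fun x : R => x - c)%R fcA.
  rewrite image_comp (_ : _ \o _ = id) ?image_id//.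
  by apply/funext => x /=; rewrite addrAC subrr add0r.
rewrite /counting !asboolT//; last exact: finite_image.
by rewrite fset_set_image// card_imfset.
Qed.

(** In the discrete set-up the invariance holds under integer shifts only, which
    is why the walk is followed on the lattice below. *)
Lemma refmeas_translation s (c : R) (A : set R) : lattice s c -> measurable A ->
  pushforward (refmeas s) (fun x : measurableTypeR R => c + x : measurableTypeR R)%R A
  = refmeas s A.
Proof.
case: s => [_ mA|/= latc mA]; first exact: lebesgue_measure_translation.
rewrite /pushforward /mrestr.
set B := _ @^-1` A `&` _.
rewrite -(counting_translation c B); congr counting.
apply/seteqP; split => [_ [x [Ax Zx] <-]|x [Ax Zx]].
  by split => //; exact: (@latticeD DiscreteSetup).
exists (x - c)%R; last by rewrite subrKC.
by split; [rewrite /= subrKC|exact: (@latticeB DiscreteSetup)].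
Qed.

End reference.

(** * Partition functions as iterated transfer operators *)

Section partition.
Context {R : realType}.
Variables (s : setup) (V : R -> \bar R).
Hypothesis V_ninfty : forall x, V x != -oo%E.
Hypothesis V_cont : s = ContinuousSetup -> continuous (fun x : R => expeR (- V x)%E).
Local Open Scope ereal_scope.

(** The Boltzmann weight of an increment, set to 0 off the lattice to make it
    measurable. *)
Definition weight : measurableTypeR R -> \bar R := (fun x => expeR (- V x)) \_ (lattice s).

Lemma weightE x : lattice s x -> weight x = expeR (- V x).
Proof. by move=> sx; rewrite /weight patchE mem_set. Qed.

Lemma weight_ge0 x : 0 <= weight x.
Proof. by rewrite /weight; apply: erestrict_ge0 => *; exact: expeR_ge0. Qed.

Lemma expeRN_fin x : V x != -oo -> (expeR (- V x)) \is a fin_num.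
Proof. by case: (V x). Qed.

Lemma measurable_weight : measurable_fun setT weight.
Proof.
rewrite /weight; case: s V_cont => [Vc|_].
  rewrite patch_setT.
  have Vfin x : expeR (- V x) = (fine (expeR (- V x)))%:E.
    by rewrite fineK// expeRN_fin.
  under eq_fun do rewrite Vfin.
  apply/measurable_EFinP.
  have : continuous (fun x : R => fine (expeR (- V x))).
    move=> x; apply: fine_cvg; rewrite -Vfin; exact: (Vc erefl x).
  exact: continuous_measurable_fun.
move=> _ B mB; rewrite setTI.
set f := _ \_ _.
(* The weight vanishes off a countable set, so a preimage is countable or has a
   countable complement *)
have cnt (A : set (measurableTypeR R)) : A `<=` lattice DiscreteSetup -> measurable A.
  move=> Asub; apply: countable_measurable; first by move=> t; exact: measurable_set1.
  apply: sub_countable (countableP [set: int]).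
  apply: card_le_trans (subset_card_le Asub) _; exact: card_image_le.
have f0 x : ~ lattice DiscreteSetup x -> f x = 0.
  by move=> nx; rewrite /f patchE memNset.
have [B0|B0] := pselect (B 0).
  rewrite -(setCK (f @^-1` B)); apply: measurableC; apply: cnt => x /= nB.
  by apply: contrapT => /f0 fx; apply: nB; rewrite fx.
apply: cnt => x /= Bfx; apply: contrapT => /f0 fx; apply: B0; rewrite -fx//.
Qed.

Lemma refmeas_integral_weight (D : set (measurableTypeR R)) :
  \int[refmeas s]_(x in D) expeR (- V x) = \int[sf_refmeas s]_(x in D) weight x.
Proof.
apply: (eq_integral_null (measurable_lattice s) (lattice_full s)).
- by move=> x _; exact: expeR_ge0.
- by move=> x _; exact: weight_ge0.
- by move=> x sx _; rewrite weightE.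
Qed.

Lemma integral_pin (eps : {nonneg R}) (f : measurableTypeR R -> \bar R) :
  measurable_fun setT f -> (forall x, 0 <= f x) ->
  \int[pin_measure s eps]_(x in `[0%R, +oo[) f x =
  \int[sf_refmeas s]_(x in `]0%R, +oo[) f x + eps%:num%:E * f 0%R.
Proof.
move=> mf f0.
have mpos : measurable (`]0%R, +oo[%classic : set (measurableTypeR R)).
  exact: measurable_itv.
have mnneg : measurable (`[0%R, +oo[%classic : set (measurableTypeR R)).
  exact: measurable_itv.
rewrite /pin_measure ge0_integral_measure_add//; last exact: measurable_funTS.
congr (_ + _); last first.
  rewrite ge0_integral_mscale//; last exact: measurable_funTS.
  rewrite integral_dirac//; last exact: measurable_funTS.
  by rewrite diracE mem_set ?mul1e//= in_itv/= lexx.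
rewrite integral_mkcond ge0_integral_mrestr; last first.
  by move=> x; exact: erestrict_ge0.
apply: eq_integral => x /set_mem/=; rewrite in_itv/= andbT => x0.
by rewrite patchE mem_set//= in_itv/= andbT ltW.
Qed.

Lemma integral_pin_lattice (eps : {nonneg R}) (f g : measurableTypeR R -> \bar R) :
  (forall x, 0 <= f x) -> (forall x, 0 <= g x) ->
  (forall x, lattice s x -> f x = g x) ->
  \int[pin_measure s eps]_(x in `[0%R, +oo[) f x =
  \int[pin_measure s eps]_(x in `[0%R, +oo[) g x.
Proof.
move=> f0 g0 fg; apply: (eq_integral_null (measurable_lattice s)) => //; last by move=> x /fg.
have e2 : mscale eps (\d_(0%R : measurableTypeR R)) (~` lattice s) = 0.
  have d0 : \d_(0%R : measurableTypeR R) (~` lattice s) = 0 :> \bar R.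
    by rewrite diracE memNset//; apply; exact: lattice0.
  exact: etrans (congr1 (fun t => eps%:num%:E * t) d0) (mule0 _).
have e1 : mrestr (refmeas s) (measurable_itv `](0 : R)%R, +oo[) (~` lattice s) = 0.
  rewrite /mrestr; apply: (subset_measure0 (B := ~` lattice s)).
  - apply: measurableI; last exact: measurable_itv.
    by apply: measurableC; exact: measurable_lattice.
  - by apply: measurableC; exact: measurable_lattice.
  - exact: subIsetl.
  - exact: lattice_full.
exact: etrans (measure_addE _ _ _) (etrans (congr2 adde e1 e2) (adde0 0)).
Qed.

Local Notation killed := (killed_step (sf_refmeas s) weight).
Local Notation pinned := (pinned_step (sf_refmeas s) weight).

(** The chain structure of the energy, GS, turns the iterated integral into an
    iterated operator. The constant c collects the weights of the steps already
    integrated, which lets the induction go through the integrals one at a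
    time. *)
Lemma integral_pos_iter (eps : {nonneg R}) (G : R -> seq R -> \bar R)
    (g : measurableTypeR R -> \bar R) :
  nonneg_measurable g ->
  (forall x l, 0 <= G x l) ->
  (forall x y l, G x (y :: l) = expeR (- V (y - x)%R) * G y l) ->
  (forall x, lattice s x -> G x [::] = g x) ->
  forall N x (c : {nonneg R}), lattice s x ->
  integral_pos (pin_measure s eps) N (fun l => c%:num%:E * G x l) =
  c%:num%:E * iter N (pinned eps%:num) g x.
Proof.
move=> mg G0 GS Gg; have TL : nonneg_linear (pinned eps%:num).
  by apply: nonneg_linear_pinned => //; [exact: measurable_weight|exact: weight_ge0].
elim=> [|N IH] x c sx; first by rewrite /= Gg.
rewrite [LHS]/=.
have mT := nonneg_measurable_iter N TL mg.
pose f (y : measurableTypeR R) := weight (y - x)%R * iter N (pinned eps%:num) g y.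
have f0 y : 0 <= f y by rewrite mule_ge0 ?weight_ge0//; exact: mT.2.
have mf : measurable_fun setT f.
  apply: emeasurable_funM; last exact: mT.1.
  exact: (measurable_shifted_weight measurable_weight).
transitivity (\int[pin_measure s eps]_(y in `[0%R, +oo[) (c%:num%:E * f y)).
  apply: integral_pin_lattice.
  - by move=> y; apply: integral_pos_ge0 => l; rewrite mule_ge0.
  - by move=> y; rewrite mule_ge0.
  move=> y sy.
  have wfin := expeRN_fin (V_ninfty (y - x)%R).
  pose u : {nonneg R} := NngNum (fine_ge0 (expeR_ge0 (- V (y - x)%R))).
  have wE : expeR (- V (y - x)%R) = u%:num%:E by rewrite /= fineK.
  under [X in integral_pos _ _ X]eq_fun do rewrite GS wE muleA -EFinM.
  have /= -> := IH y (c%:num * u%:num)%:nng%R sy.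
  rewrite EFinM -muleA; congr (_ * _).
  by rewrite /f weightE ?fineK//; exact: latticeB.
rewrite integral_pin//; last 2 first.
- exact: measurable_funeM.
- by move=> y; rewrite mule_ge0.
rewrite ge0_integralZl_EFin//; last exact: measurable_funTS.
rewrite muleCA -ge0_muleDr//; last 2 first.
- by apply: integral_ge0 => y _.
- by rewrite mule_ge0 ?lee_fin.
by rewrite {2}/f sub0r.
Qed.

Lemma energy_ninfty (l : seq R) : energy V l != -oo.
Proof.
rewrite /energy; elim: (_.-1) => [|n IH]; first by rewrite big_geq.
by rewrite big_nat_recr//= adde_eq_ninfty negb_or IH V_ninfty.
Qed.

Lemma energy_cons x y (l : seq R) : energy V [:: x, y & l] = V (y - x)%R + energy V (y :: l).
Proof. by rewrite /energy/= big_nat_recl. Qed.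

(** Potentials of value +oo are allowed: both sides are then 0. *)
Lemma expeR_energy_cons x y (l : seq R) :
  expeR (- energy V [:: x, y & l]) = expeR (- V (y - x)%R) * expeR (- energy V (y :: l)).
Proof.
rewrite energy_cons; have := energy_ninfty (y :: l); have := V_ninfty (y - x)%R.
case: (V _) => [a| |]//; case: (energy _ _) => [b| |]//= _ _; rewrite ?mule0 ?mul0e//.
by rewrite -EFinM -expRD opprD.
Qed.

Lemma Zc_iter (eps : {nonneg R}) N :
  Zc s V eps N = iter N (pinned eps%:num) (fun x => weight (- x)%R) 0%R.
Proof.
rewrite -[RHS]mul1e.
apply: etrans (@integral_pos_iter eps (fun x l => expeR (- energy V (x :: rcons l 0%R)))
  (fun x => weight (- x)%R) _ _ _ _ N 0%R (1%:nng)%R (lattice0 s)).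
- rewrite /Zc; congr integral_pos; apply/funext => l.
  by rewrite /Hc mul1e.
- by apply: nonneg_measurable_weight; [exact: measurable_weight|exact: weight_ge0].
- by move=> x l; exact: expeR_ge0.
- by move=> x y l; rewrite rcons_cons expeR_energy_cons.
- move=> x sx /=; rewrite weightE; last by rewrite -sub0r; exact: (latticeB (lattice0 s)).
  by rewrite /energy big_nat1/= sub0r.
Qed.

Lemma Zf_iter (eps : {nonneg R}) N :
  Zf s V eps N = iter N (pinned eps%:num) (cst 1) 0%R.
Proof.
rewrite -[RHS]mul1e.
apply: etrans (@integral_pos_iter eps (fun x l => expeR (- energy V (x :: l)))
  (cst 1) _ _ _ _ N 0%R (1%:nng)%R (lattice0 s)).
- rewrite /Zf; congr integral_pos; apply/funext => l.
  by rewrite /Hf mul1e.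
- by split.
- by move=> x l; exact: expeR_ge0.
- by move=> x y l; rewrite expeR_energy_cons.
- by move=> x sx /=; rewrite /energy big_geq//= oppr0 expR0.
Qed.

End partition.

(** * Restricted laws and densities *)

Section restricted_law.
Local Open Scope ereal_scope.
Context d d' (T : measurableType d) (T' : measurableType d') (R : realType).
Variables (P : probability T R) (E : set T) (mE : measurable E).
Variables (X : T -> T') (mX : measurable_fun setT X).

(** The law of X on the event E, not normalised. The measurability proofs are
    arguments so that measure structures can be attached. *)
Definition restricted_law (mE : measurable E) (mX : measurable_fun setT X)
  (A : set T') : \bar R := P (E `&` X @^-1` A).

Local Notation law := (restricted_law mE mX).

Let mpre A : measurable A -> measurable (X @^-1` A).
Proof. by move=> mA; rewrite -[X in measurable X]setTI; exact: mX. Qed.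

Let law0 : law set0 = 0.
Proof. by rewrite /restricted_law preimage_set0 setI0 measure0. Qed.

Let law_ge0 A : 0 <= law A.
Proof. exact: measure_ge0. Qed.

Let law_sigma_additive : semi_sigma_additive law.
Proof.
move=> F mF tF mUF; rewrite /restricted_law preimage_bigcup setI_bigcupr.
apply: measure_semi_sigma_additive.
- by move=> n; apply: measurableI => //; exact: mpre.
- apply/trivIsetP => /= i j _ _ ij; rewrite setIACA -preimage_setI.
  by move/trivIsetP : tF => /(_ _ _ _ _ ij) ->//; rewrite preimage_set0 setI0.
- by rewrite -setI_bigcupr -preimage_bigcup; apply: measurableI => //; exact: mpre.
Qed.

HB.instance Definition _ := isMeasure.Build _ _ _ law law0 law_ge0 law_sigma_additive.

Let law_fin : fin_num_fun law.
Proof.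
move=> A mA; rewrite ge0_fin_numE//; apply: le_lt_trans (ltry 1).
by apply: probability_le1; apply: measurableI => //; exact: mpre.
Qed.

HB.instance Definition _ := @Measure_isFinite.Build _ _ _ law law_fin.

End restricted_law.

Section integral_tools.
Local Open Scope ereal_scope.
Context d (T : measurableType d) (R : realType).
Import HBNNSimple.

Variables (mu nu : {measure set T -> \bar R}) (w : T -> \bar R).
Hypotheses (mw : measurable_fun setT w) (w0 : forall x, 0 <= w x).
Hypothesis w_fin : forall x, w x \is a fin_num.
Hypothesis nuE : forall A, measurable A -> nu A = \int[mu]_(x in A) w x.

(** True for simple functions by hypothesis, hence for f by monotone
    convergence. *)
Lemma ge0_integral_density (f : T -> \bar R) : measurable_fun setT f ->
  (forall x, 0 <= f x) -> \int[nu]_x f x = \int[mu]_x (f x * w x).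
Proof.
move=> mf f0; pose h := nnsfun_approx measurableT mf.
have -> : \int[nu]_x f x = lim (\int[nu]_x (EFin \o h n) x @[n --> \oo]).
  have fE x : f x = lim ((EFin \o h n) x @[n --> \oo]).
    by apply/esym/cvg_lim => //; exact: cvg_nnsfun_approx.
  under eq_integral do rewrite fE.
  apply: monotone_convergence => //.
  - by move=> n; exact/measurable_EFinP.
  - by move=> n x Ex //=; rewrite lee_fin.
  - by move=> x Ex a b ab; rewrite lee_fin; exact/lefP/nd_nnsfun_approx.
have -> : \int[mu]_x (f x * w x) =
    lim (\int[mu]_x ((EFin \o h n) \* w) x @[n --> \oo]).
  have fg x : f x * w x = lim (((EFin \o h n) \* w) x @[n --> \oo]).
    by apply/esym/cvg_lim => //; apply: cvgeZr => //; exact: cvg_nnsfun_approx.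
  under eq_integral do rewrite fg.
  apply: monotone_convergence => [//| | |].
  - by move=> n; apply/emeasurable_funM => //; exact/measurable_EFinP.
  - by move=> n x Ex /=; rewrite mule_ge0 ?lee_fin.
  - by move=> x Ex a b ab/=; rewrite lee_wpmul2r ?lee_fin//; exact/lefP/nd_nnsfun_approx.
congr (lim (_ @ \oo)); apply/funext => n.
transitivity (\int[nu]_x
   (\sum_(y \in range (h n)) (y * \1_(h n @^-1` [set y]) x)%:E)).
  by apply: eq_integral => t tE; rewrite /= fimfunE -fsumEFin.
rewrite ge0_integral_fsum//; last 2 first.
  - by move=> r; exact/measurable_EFinP/measurableT_comp.
  - by move=> m y Ey; exact: nnfun_muleindic_ge0.
transitivity (\int[mu]_x (\sum_(y \in range (h n))
    (y * \1_(h n @^-1` [set y]) x)%:E * w x)); last first.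
  apply: eq_integral => x _.
  rewrite -ge0_mule_fsuml => [|y]; last exact: nnfun_muleindic_ge0.
  by rewrite fsumEFin // -(fimfunE _ x).
rewrite ge0_integral_fsum//; last 2 first.
  - by move=> y; apply: emeasurable_funM => //; exact/measurable_EFinP/measurableT_comp.
  - by move=> m y Ey; rewrite mule_ge0// nnfun_muleindic_ge0.
apply: eq_fsbigr => r rhn.
under eq_integral do rewrite EFinM.
rewrite integralZl_indic_nnsfun//.
have [r0|r0] := leP 0%R r; last first.
  rewrite preimage_nnfun0//.
  rewrite [RHS]integral0_eq; last by move=> x _; rewrite indic0 mulr0 mul0e.
  by rewrite integral_indic// set0I measure0 mule0.
under [RHS]eq_integral do rewrite EFinM -muleA.
rewrite [RHS]ge0_integralZl//; last 2 first.
- by apply: emeasurable_funM => //; exact/measurable_EFinP.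
- by move=> x _; rewrite mule_ge0// lee_fin.
congr (_ * _); rewrite integral_indic// setIT nuE//.
rewrite integral_mkcond; apply: eq_integral => x _.
by rewrite epatch_indic muleC.
Qed.

End integral_tools.

(** * The walk restricted to staying positive *)

Section positive_walk.
Context {d : measure_display} {T : measurableType d} {R : realType}.
Variables (P : probability T R) (s : setup) (Y : nat -> {RV P >-> R}).
Hypothesis Y_indep : mutually_independent Y.
Local Open Scope ereal_scope.
Local Notation RR := (measurableTypeR R).

(** The walk stays positive and all its steps are on the lattice. The second
    condition has probability 1; imposing it keeps the walk where translation
    invariance applies. *)
Definition positive_on_lattice (n : nat) : set T :=
  [set w | (forall i, (1 <= i <= n)%N -> (0 < walk Y i w)%R) /\
           (forall i, (i < n)%N -> lattice s (Y i w))].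

Lemma measurable_step i : measurable_fun setT (Y i : T -> RR).
Proof. exact: (@measurable_funP _ _ _ _ _ (Y i)). Qed.

Lemma walkS n w : walk Y n.+1 w = (walk Y n w + Y n w)%R.
Proof. by rewrite /walk big_ord_recr. Qed.

Lemma measurable_walk n : measurable_fun setT (walk Y n : T -> RR).
Proof.
elim: n => [|n IH].
  rewrite (_ : walk Y 0 = cst 0%R); first exact: measurable_cst.
  by apply/funext => w; rewrite /walk big_ord0.
rewrite (_ : walk Y n.+1 = (fun w => walk Y n w + Y n w)%R).
  apply: measurable_funD; [exact: IH|exact: measurable_step].
by apply/funext => w; rewrite walkS.
Qed.

Definition good_increments : set (RR * RR) :=
  [set z | (0 < z.1 + z.2)%R /\ lattice s z.2].

Lemma positive_on_latticeS n : positive_on_lattice n.+1 =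
  positive_on_lattice n `&` (fun w => (walk Y n w : RR, Y n w : RR)) @^-1` good_increments.
Proof.
apply/seteqP; split => w /=.
  move=> [h1 h2]; split; [split|split].
  - by move=> i /andP[i0 i1]; apply: h1; rewrite i0 leqW.
  - by move=> i i0; apply: h2; rewrite ltnW.
  - by rewrite /= -walkS; apply: h1; rewrite leqnn.
  - exact: h2.
move=> [[h1 h2] [/= h3 h4]]; split.
  move=> i /andP[i0]; rewrite leq_eqVlt => /predU1P[->|]; first by rewrite walkS.
  by rewrite ltnS => i1; apply: h1; rewrite i0.
by move=> i; rewrite ltnS leq_eqVlt => /predU1P[->//|]; exact: h2.
Qed.

Lemma measurable_good_increments : measurable good_increments.
Proof.
have -> : good_increments =
    (fun z : RR * RR => (z.1 + z.2)%R : RR) @^-1` `]0%R, +oo[%classic `&`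
    snd @^-1` (lattice s).
  by apply/seteqP; split => z /=; rewrite /good_increments/= in_itv/= andbT.
apply: measurableI.
  rewrite -[X in measurable X]setTI.
  have mD : measurable_fun setT (fun z : RR * RR => (z.1 + z.2)%R : RR).
    by apply: measurable_funD; [exact: measurable_fst|exact: measurable_snd].
  by apply: mD => //; exact: measurable_itv.
rewrite -[X in measurable X]setTI; apply: measurable_snd => //; exact: measurable_lattice.
Qed.

Lemma measurable_pair_walk n :
  measurable_fun setT (fun w => (walk Y n w : RR, Y n w : RR)).
Proof. by apply: measurable_fun_pair; [exact: measurable_walk|exact: measurable_step]. Qed.

Lemma measurable_preimage d1 d' (T1 : measurableType d1) (T' : measurableType d')
    (X : T1 -> T') (A : set T') :
  measurable_fun setT X -> measurable A -> measurable (X @^-1` A).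
Proof. by move=> mX mA; rewrite -[X in measurable X]setTI; exact: mX. Qed.

Lemma measurable_positive_on_lattice n : measurable (positive_on_lattice n).
Proof.
elim: n => [|n IH].
  rewrite (_ : positive_on_lattice 0 = setT)//.
  by apply/seteqP; split => // w _; split => // i; lia.
rewrite positive_on_latticeS; apply: measurableI => //.
apply: measurable_preimage; [exact: measurable_pair_walk|exact: measurable_good_increments].
Qed.

Definition step_law i := restricted_law P measurableT (measurable_step i).

Definition walk_law n :=
  restricted_law P (measurable_positive_on_lattice n) (measurable_walk n).

(** A cylinder event on the steps in J. *)
Definition future (J : seq nat) (A : nat -> set R) : set T :=
  \bigcap_(i in [set` J]) (Y i @^-1` A i).

Lemma measurable_future J A : (forall i, measurable (A i)) -> measurable (future J A).
Proof.
move=> mA; apply: fin_bigcap_measurable => [|i _]; first exact: finite_seq.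
exact: (measurable_preimage (measurable_step i) (mA i)).
Qed.

Lemma future_cons n J A (C : set R) : n \notin J ->
  future (n :: J) (fun i => if i == n then C else A i) = future J A `&` Y n @^-1` C.
Proof.
move=> nJ; apply/seteqP; split => w /=.
  move=> h; split.
    move=> i /= iJ; have := h i; rewrite /= inE iJ orbT => /(_ isT).
    by case: eqP => // ein; move: nJ; rewrite -ein iJ.
  by have := h n; rewrite /= inE eqxx => /(_ isT).
move=> [h1 h2] i /=; rewrite inE; case: eqP => [->//|_ /= iJ]; exact: h1.
Qed.

Lemma future_step n J A (C : set R) : uniq J -> n \notin J ->
  (forall i, measurable (A i)) -> measurable C ->
  P (future J A `&` Y n @^-1` C) = P (future J A) * step_law n C.
Proof.
move=> uJ nJ mA mC; rewrite -future_cons// /future Y_indep//=; last 2 first.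
- by rewrite nJ.
- by move=> i; case: ifP.
rewrite big_cons eqxx muleC Y_indep//; congr (_ * _); last first.
  by rewrite /step_law /restricted_law setTI.
rewrite [LHS]big_seq [RHS]big_seq; apply: eq_bigr => i iJ.
by case: eqP => // ein; move: nJ; rewrite -ein iJ.
Qed.

Lemma walk_step_event J A n (C : set R) :
  (future J A `&` positive_on_lattice n.+1) `&` walk Y n.+1 @^-1` C =
  (future J A `&` positive_on_lattice n) `&` (fun w => (walk Y n w : RR, Y n w : RR)) @^-1`
    (good_increments `&` (fun z => (z.1 + z.2)%R : RR) @^-1` C).
Proof.
rewrite positive_on_latticeS preimage_setI !setIA; congr (_ `&` _).
by apply/seteqP; split => w /=; rewrite walkS.
Qed.

Lemma future_nil A : future [::] A = setT.
Proof. by apply/seteqP; split. Qed.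

Lemma positive_on_lattice0 : positive_on_lattice 0 = setT.
Proof. by apply/seteqP; split => // w _; split => // i; lia. Qed.

Lemma measurable_add_pair (C : set RR) : measurable C ->
  measurable ((fun z : RR * RR => (z.1 + z.2)%R : RR) @^-1` C).
Proof.
move=> mC.
have madd : measurable_fun setT (fun z : RR * RR => (z.1 + z.2)%R : RR).
  by apply: measurable_funD; [exact: measurable_fst|exact: measurable_snd].
exact: (measurable_preimage madd mC).
Qed.

Definition independent_of_future n := forall J A (C : set R),
  uniq J -> (forall j, j \in J -> (n <= j)%N) ->
  (forall i, measurable (A i)) -> measurable C ->
  P ((future J A `&` positive_on_lattice n) `&` walk Y n @^-1` C) =
  P (future J A) * walk_law n C.

(** Conditioning further on Y n in C2 just adds n to J, so the law of
    (walk n, Y n) on the event is a product on rectangles, hence everywhere. *)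
Lemma joint_law n : independent_of_future n ->
  forall J A (D : set (RR * RR)), uniq J -> (forall j, j \in J -> (n < j)%N) ->
  (forall i, measurable (A i)) -> measurable D ->
  P ((future J A `&` positive_on_lattice n) `&`
      (fun w => (walk Y n w : RR, Y n w : RR)) @^-1` D) =
  P (future J A) * (walk_law n \x step_law n)%E D.
Proof.
move=> IH J A D uJ nJ mA mD.
have nnJ : n \notin J by apply/negP => /nJ; rewrite ltnn.
have rect C1 C2 : measurable C1 -> measurable C2 ->
    P ((future J A `&` positive_on_lattice n) `&`
      (fun w => (walk Y n w : RR, Y n w : RR)) @^-1` (C1 `*` C2)) =
    walk_law n C1 * (P (future J A) * step_law n C2).
  move=> mC1 mC2; rewrite -future_step// -future_cons// muleC -IH//.
  - rewrite future_cons//; congr (P _).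
    by apply/seteqP; split => w /=; [move=> [[? ?] [? ?]]|move=> [[[? ?] ?] ?]].
  - by rewrite /= nnJ.
  - by move=> j; rewrite inE => /predU1P[->//|/nJ/ltnW].
  - by move=> i; case: ifP.
have mFB : measurable (future J A `&` positive_on_lattice n).
  by apply: measurableI; [exact: measurable_future|exact: measurable_positive_on_lattice].
pose lF := restricted_law P mFB (measurable_pair_walk n).
pose k : {nonneg R} := NngNum (fine_ge0 (measure_ge0 P (future J A))).
have kE : k%:num%:E = P (future J A).
  by rewrite /= fineK// fin_num_measure//; exact: measurable_future.
have hF := @product_measure_unique _ _ RR RR R (walk_law n) (mscale k (step_law n)) lF.
have hT := @product_measure_unique _ _ RR RR R (walk_law n) (mscale k (step_law n))
  (mscale k (walk_law n \x step_law n)%E).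
rewrite -kE; apply: etrans (esym (hF _ D mD)) (hT _ D mD) => C1 C2 mC1 mC2.
  have e : P (future J A) * step_law n C2 = mscale k (step_law n) C2 by rewrite /mscale kE.
  exact: etrans (rect C1 C2 mC1 mC2) (congr1 _ e).
exact: etrans (congr1 (fun t => k%:num%:E * t)
  (product_measure1E (walk_law n) (step_law n) mC1 mC2)) (muleCA _ _ _).
Qed.

(** The event J on later steps is carried along because the induction uses the
    independence of the walk and of Y n, jointly with J, through
    [joint_law]. *)
Lemma walk_independent_of_future n : independent_of_future n.
Proof.
elim: n => [|n IH] J A C uJ nJ mA mC.
  rewrite /walk_law /restricted_law positive_on_lattice0 setIT setTI.
  have [C0|C0] := pselect (C 0%R).
    have -> : walk Y 0 @^-1` C = setT.
      by apply/seteqP; split => // w _; rewrite /= /walk big_ord0.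
    by rewrite setIT probability_setT mule1.
  have -> : walk Y 0 @^-1` C = set0.
    by apply/seteqP; split => // w; rewrite /= /walk big_ord0.
  by rewrite setI0 measure0 mule0.
have mD : measurable (good_increments `&` (fun z : RR * RR => (z.1 + z.2)%R : RR) @^-1` C).
  by apply: measurableI; [exact: measurable_good_increments|exact: measurable_add_pair].
rewrite walk_step_event joint_law//; congr (_ * _).
rewrite /walk_law /restricted_law -[positive_on_lattice n.+1]setTI -(future_nil A).
by rewrite walk_step_event joint_law// future_nil probability_setT mul1e.
Qed.

Lemma walk_lawS n (C : set RR) : measurable C ->
  walk_law n.+1 C = (walk_law n \x step_law n)%E
    (good_increments `&` (fun z : RR * RR => (z.1 + z.2)%R : RR) @^-1` C).
Proof.
move=> mC.
have mD : measurable (good_increments `&` (fun z : RR * RR => (z.1 + z.2)%R : RR) @^-1` C).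
  by apply: measurableI; [exact: measurable_good_increments|exact: measurable_add_pair].
rewrite /walk_law /restricted_law -[positive_on_lattice n.+1]setTI -(future_nil (fun=> setT)).
rewrite walk_step_event (joint_law (@walk_independent_of_future n))//.
by rewrite future_nil probability_setT mul1e.
Qed.

Lemma walk_law_lattice n : walk_law n (~` lattice s) = 0.
Proof.
rewrite /walk_law /restricted_law (_ : _ `&` _ = set0) ?measure0//.
apply/seteqP; split => // w /= [[_ Bw]]; apply.
elim: n Bw => [|n IH] Bw; first by rewrite /walk big_ord0; exact: lattice0.
rewrite walkS; apply: latticeD; last exact: Bw.
by apply: IH => i /ltnW; exact: Bw.
Qed.

Variables (w : RR -> \bar R) (kap : R).
Hypotheses (mw : measurable_fun setT w) (w0 : forall x, 0 <= w x).
Hypothesis w_fin : forall x, w x \is a fin_num.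
Hypothesis w_lattice : forall x, ~ lattice s x -> w x = 0.
Hypothesis kap0 : (0 < kap)%R.
Hypothesis Y_law : forall i (A : set RR), measurable A ->
  P (Y i @^-1` A) = kap^-1%:E * \int[sf_refmeas s]_(x in A) w x.

Local Notation killed := (killed_step (sf_refmeas s) w).

(** The substitution z = x + y, by translation invariance; it is here that x has
    to be on the lattice. *)
Lemma step_integral i (x : RR) (g : RR -> \bar R) : nonneg_measurable g -> lattice s x ->
  \int[step_law i]_y ((\1_good_increments (x, y))%:E * g (x + y)%R) =
  kap^-1%:E * killed g x.
Proof.
move=> [mg g0] sx.
have k0 : 0 <= kap^-1%:E :> \bar R by rewrite lee_fin invr_ge0 ltW.
have mx : measurable_fun setT (fun y : RR => (x + y)%R : RR) by exact: measurable_addl.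
have mgx : measurable_fun setT (fun y : RR => g (x + y)%R) by exact: measurableT_comp.
have mind : measurable_fun setT (fun y : RR => (\1_good_increments (x, y))%:E : \bar R).
  apply/measurable_EFinP.
  have h : measurable_fun setT (\1_good_increments : RR * RR -> R).
    by apply: measurable_indic; exact: measurable_good_increments.
  exact: (measurableT_comp h (measurable_pair1 x)).
rewrite (@ge0_integral_density _ _ R (sf_refmeas s) (step_law i) (fun y => kap^-1%:E * w y)).
- rewrite killed_stepE.
  have mphi := measurableT_comp (measurable_kernel_prod mw mg) (measurable_pair1 x).
  set phi := (fun y : RR => (\1_(`]0%R, +oo[%classic : set R) y)%:E * (w (y - x)%R * g y)).
  have {}mphi : measurable_fun setT phi by exact: mphi.
  have mphix : measurable_fun setT (phi \o (fun y : RR => (x + y)%R : RR)).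
    exact: (measurableT_comp mphi mx).
  have phi0 y : 0 <= phi y by rewrite mule_ge0 ?lee_fin// mule_ge0.
  have -> : \int[sf_refmeas s]_y phi y =
      \int[pushforward (sf_refmeas s) (fun y : RR => (x + y)%R : RR)]_y phi y.
    apply: eq_measure_integral => A mA _.
    exact: esym (refmeas_translation sx mA).
  rewrite (ge0_integral_pushforward mx)// preimage_setT.
  rewrite -[in RHS]ge0_integralZl//; last by move=> y _; exact: phi0.
  apply: eq_integral => y _; rewrite /= muleCA; congr (_ * _).
  rewrite /phi addrAC subrr add0r.
  have [sy|sy] := pselect (lattice s y); last by rewrite w_lattice// !(mule0,mul0e).
  rewrite -muleA [g _ * _]muleC; congr (_ * _); congr EFin.
  rewrite !indicE; congr (_%:R); congr nat_of_bool.
  apply/idP/idP => /set_mem.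
    by move=> [/= h _]; rewrite inE/= in_itv/= h.
  by rewrite /= in_itv/= andbT => h; rewrite inE; split.
- exact: measurable_funeM.
- by move=> y; rewrite mule_ge0.
- by move=> y; rewrite fin_numM.
- move=> A mA; rewrite ge0_integralZl//; last exact: measurable_funTS.
  rewrite -(Y_law i)//.
  by congr (P _); rewrite setTI.
- by apply: emeasurable_funM.
- by move=> y; rewrite mule_ge0 ?lee_fin.
Qed.

(** One step of the walk, averaged with Fubini over the law of the next
    increment, is one application of the killed transfer operator divided by
    kap. *)
Lemma walk_law_integral n (g : RR -> \bar R) : nonneg_measurable g ->
  \int[walk_law n]_x g x = (kap ^- n)%:E * iter n killed g 0%R.
Proof.
have k0 : 0 <= kap^-1%:E :> \bar R by rewrite lee_fin invr_ge0 ltW.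
have AL : nonneg_linear killed by exact: nonneg_linear_killed.
elim: n g => [|n IH] g mg.
  rewrite expr0 invr1 mul1e /=; have [mg' g0] := mg.
  transitivity (\int[\d_(0%R : RR)]_x g x); last first.
    by rewrite integral_dirac// diracT mul1e.
  apply: eq_measure_integral => A mA _.
  rewrite /walk_law /= /restricted_law positive_on_lattice0 setTI.
  rewrite diracE; case: (boolP (_ \in A)) => /=.
    move=> /set_mem A0; rewrite (_ : _ @^-1` _ = setT) ?probability_setT//.
    by apply/seteqP; split => // t _; rewrite /= /walk big_ord0.
  move=> /negP A0; rewrite (_ : _ @^-1` _ = set0) ?measure0//.
  apply/seteqP; split => // t; rewrite /= /walk big_ord0 => A0'.
  by apply: A0; exact: mem_set.
have [mg' g0] := mg.
pose add (z : RR * RR) : RR := (z.1 + z.2)%R.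
have madd : measurable_fun setT add.
  by apply: measurable_funD; [exact: measurable_fst|exact: measurable_snd].
transitivity (\int[pushforward (mrestr (walk_law n \x step_law n)%E
    measurable_good_increments) add]_x g x).
  apply: eq_measure_integral => A mA _.
  by rewrite [LHS]walk_lawS// setIC.
rewrite (ge0_integral_pushforward madd)// preimage_setT ge0_integral_mrestr; last first.
  by move=> z; exact: g0.
rewrite integral_mkcond.
have mind : measurable_fun setT (\1_good_increments : RR * RR -> R).
  by apply: measurable_indic; exact: measurable_good_increments.
transitivity (\int[(walk_law n \x step_law n)%E]_z ((\1_good_increments z)%:E * g (add z))).
  by apply: eq_integral => z _; rewrite epatch_indic muleC.
rewrite fubini_tonelli1; last 2 first.
- apply: emeasurable_funM; first exact/measurable_EFinP.
  exact: (measurableT_comp mg' madd).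
- by move=> z; rewrite mule_ge0// lee_fin.
transitivity (\int[walk_law n]_x (kap^-1%:E * killed g x)).
  apply: (eq_integral_null (measurable_lattice s)).
  - exact: walk_law_lattice.
  - by move=> x _; apply: integral_ge0 => y _; rewrite mule_ge0// lee_fin.
  - by move=> x _; rewrite mule_ge0//; exact: (AL.1 _ mg).2.
  - by move=> x sx _; rewrite -(step_integral n mg sx).
have mAg := AL.1 _ mg.
rewrite ge0_integralZl//; [|exact: mAg.1|by move=> x _; exact: mAg.2].
rewrite IH// muleA -EFinM -invfM -exprS iterSr.
by [].
Qed.

Lemma positive_walk_prob n :
  iter n killed (cst 1) 0%R = (kap ^+ n * positivity_prob Y n)%:E.
Proof.
suff PE : P [set t | forall i, (1 <= i <= n)%N -> (0 < walk Y i t)%R] = walk_law n setT.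
  rewrite EFinM /positivity_prob PE fineK ?fin_num_measure//.
  rewrite -[X in _ = _ * X]mul1e -integral_cst// walk_law_integral; last by split.
  by rewrite muleA -EFinM mulfV ?mul1e// expf_neq0// gt_eqF.
transitivity (P (positive_on_lattice n)); last first.
  by rewrite /walk_law /= /restricted_law preimage_setT setIT.
(* E k interpolates between the event and [positive_on_lattice n] *)
pose E k := [set t : T | (forall i, (1 <= i <= n)%N -> (0 < walk Y i t)%R) /\
  (forall i, (i < k)%N -> lattice s (Y i t))].
have ES k : E k.+1 = E k `&` Y k @^-1` (lattice s).
  apply/seteqP; split => t /=.
    by move=> [h1 h2]; split; [split => // i ik; apply: h2; exact: ltnW|exact: h2].
  move=> [[h1 h2] h3]; split => // i; rewrite ltnS leq_eqVlt => /predU1P[->//|]; exact: h2.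
have mlat k : measurable (Y k @^-1` (lattice s)).
  exact: (measurable_preimage (measurable_step k) (measurable_lattice s)).
have E0 : E 0%N = [set t | forall i, (1 <= i <= n)%N -> (0 < walk Y i t)%R].
  by apply/seteqP; split => t /= => [[]|] //; split.
have mE k : measurable (E k).
  elim: k => [|k IH]; last by rewrite ES; exact: measurableI.
  rewrite E0 (_ : mkset _ = \bigcap_(i in [set` iota 1 n]) (walk Y i @^-1` `]0%R, +oo[)).
    apply: fin_bigcap_measurable => [|i _]; first exact: finite_seq.
    exact: (measurable_preimage (measurable_walk i) (measurable_itv _)).
  apply/seteqP; split => t /= h i.
    by rewrite /= mem_iota add1n ltnS in_itv/= andbT; exact: h.
  by move=> i1; have := h i; rewrite /= mem_iota add1n ltnS i1 in_itv/= andbT; exact.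
have null k : P (~` (Y k @^-1` (lattice s))) = 0.
  have mC := measurableC (@measurable_lattice R s).
  by have := Y_law k mC; rewrite integral0_eq ?mule0.
have PE k : P (E k) = P (E 0%N).
  elim: k => // k <-; rewrite ES.
  have -> : P (E k) = P (E k `\` Y k @^-1` (lattice s)) + P (E k `&` Y k @^-1` (lattice s)).
    exact: measureDI.
  have mD : measurable (E k `\` Y k @^-1` (lattice s)).
    by apply: measurableD; [exact: mE|exact: mlat].
  have -> : P (E k `\` Y k @^-1` (lattice s)) = 0.
    apply: (subset_measure0 mD (measurableC (mlat k)) _ (null k)).
    by move=> t [].
  by rewrite add0e.
by rewrite -E0 -(PE n).
Qed.

End positive_walk.

(** * The renewal structure of the model *)

Definition zero_nng {R : realType} : {nonneg R} := 0%:nng.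

Section assembly.
Context {R : realType}.
Variables (s : setup) (V : R -> \bar R).
Hypothesis V_ninfty : forall x, V x != -oo%E.
Hypothesis V_cont : s = ContinuousSetup -> continuous (fun x : R => expeR (- V x)%E).

Local Notation w := (weight s V).
Local Notation killed := (killed_step (sf_refmeas s) w).
Local Notation pinned := (pinned_step (sf_refmeas s) w).
Local Notation kap := (fine (kappa s V)).

Lemma pinned_step0 : pinned 0 = killed.
Proof.
by apply/funext => g; apply/funext => x; rewrite /pinned_step mul0e adde0.
Qed.

Lemma Zc_first_zero (eps : {nonneg R}) N : Zc s V eps N =
  (Zc s V zero_nng N + \sum_(0 <= k < N)
     (eps%:num%:E * Zc s V eps (N - k.+1)) * Zc s V zero_nng k)%E.
Proof.
rewrite !Zc_iter//= pinned_step0 first_zero//.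
- by congr (_ + _)%E; apply: eq_bigr => k _; rewrite !Zc_iter//= pinned_step0.
- exact: measurable_weight.
- exact: weight_ge0.
- by apply: nonneg_measurable_weight; [exact: measurable_weight|exact: weight_ge0].
Qed.

Lemma Zf_last_zero (eps : {nonneg R}) N : Zf s V eps N =
  (Zf s V zero_nng N + \sum_(0 <= k < N)
     (eps%:num%:E * Zf s V zero_nng (N - k.+1)) * Zc s V eps k)%E.
Proof.
rewrite !Zf_iter//= pinned_step0 last_zero//.
- by congr (_ + _)%E; apply: eq_bigr => k _; rewrite Zf_iter//= Zc_iter//= pinned_step0.
- exact: measurable_weight.
- exact: weight_ge0.
Qed.

Lemma Zc_ge0 (eps : {nonneg R}) N : (0 <= Zc s V eps N)%E.
Proof. by apply: integral_pos_ge0 => x; exact: expeR_ge0. Qed.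

Lemma Zc_fin (eps : {nonneg R}) : (forall n, Zc s V zero_nng n \is a fin_num) ->
  forall n, Zc s V eps n \is a fin_num.
Proof.
move=> fin0; elim/ltn_ind => n IH.
rewrite Zc_first_zero fin_numD fin0/=; apply/sum_fin_numP => k.
rewrite mem_index_iota => /andP[_ kn] _.
by rewrite !fin_numM// IH//; lia.
Qed.

Lemma fine_Zc_first_zero (eps : {nonneg R}) N : (forall n, Zc s V zero_nng n \is a fin_num) ->
  fine (Zc s V eps N) = fine (Zc s V zero_nng N) +
  \sum_(0 <= k < N) eps%:num * fine (Zc s V eps (N - k.+1)) * fine (Zc s V zero_nng k).
Proof.
move=> fin0; have fine_ := Zc_fin eps fin0.
apply: EFin_inj; rewrite EFinD -sumEFin !fineK// Zc_first_zero.
by congr (_ + _)%E; apply: eq_bigr => k _; rewrite !EFinM !fineK.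
Qed.

Lemma fine_Zf_last_zero (eps : {nonneg R}) N : (forall n, Zc s V zero_nng n \is a fin_num) ->
  (forall n, Zf s V zero_nng n \is a fin_num) ->
  fine (Zf s V eps N) = fine (Zf s V zero_nng N) +
  \sum_(0 <= k < N) eps%:num * fine (Zf s V zero_nng (N - k.+1)) * fine (Zc s V eps k).
Proof.
move=> fin0 finf0; have fine_ := Zc_fin eps fin0.
rewrite Zf_last_zero.
have -> : (Zf s V zero_nng N + \sum_(0 <= k < N)
    (eps%:num%:E * Zf s V zero_nng (N - k.+1)) * Zc s V eps k)%E =
  (fine (Zf s V zero_nng N) + \sum_(0 <= k < N)
    eps%:num * fine (Zf s V zero_nng (N - k.+1)) * fine (Zc s V eps k))%:E.
  rewrite EFinD -sumEFin !fineK//.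
  by congr (_ + _)%E; apply: eq_bigr => k _; rewrite !EFinM !fineK.
by [].
Qed.

(** [qlaw] with value 0 at 0, as renewal theory has it; [qlaw s V 0] is not a
    return probability, since it involves [0.-1 = 0]. *)
Definition return_law (n : nat) : R := if n is 0%N then 0 else qlaw s V n.

Hypothesis kap0 : 0 < kap.
Hypothesis gamma0 : fine (gamma s V) != 0.

Lemma gamma_fin : gamma s V = (fine (gamma s V))%:E.
Proof. by move: gamma0; case: (gamma s V) => //=; rewrite eqxx. Qed.

Lemma gamma_gt0 : 0 < fine (gamma s V).
Proof. by rewrite lt_neqAle eq_sym gamma0 fine_ge0// gamma_ge0. Qed.

Let term_ge0 n : (0 <= Zc s V zero_nng n.-1 * ((kap ^+ n)^-1)%:E)%E.
Proof. by rewrite mule_ge0 ?Zc_ge0// lee_fin invr_ge0 exprn_ge0// ltW. Qed.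

(** Each one is bounded by a multiple of the convergent series gamma. *)
Lemma Zc0_fin n : Zc s V zero_nng n \is a fin_num.
Proof.
have le : (Zc s V zero_nng n * ((kap ^+ n.+1)^-1)%:E <= gamma s V)%E.
  have := @nneseries_lim_ge _
    (fun n => Zc s V zero_nng n.-1 * ((kap ^+ n)^-1)%:E)%E xpredT 1 n.+2
    (fun k _ _ => term_ge0 k).
  apply: le_trans; rewrite big_nat_recr//= leeDr//.
  by apply: sume_ge0 => k _; exact: term_ge0.
rewrite gamma_fin in le; rewrite ge0_fin_numE ?Zc_ge0//.
have k1 : 0 < (kap ^+ n.+1)^-1 by rewrite invr_gt0 exprn_gt0.
have zge := Zc_ge0 zero_nng n.
move: le zge; move: (Zc s V zero_nng n) => [r| |] //; first by rewrite ltry.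
by rewrite gt0_mulye// lte_fin.
Qed.

Lemma return_law_ge0 n : 0 <= return_law n.
Proof.
case: n => //= n; rewrite /qlaw mulr_ge0 ?invr_ge0 ?(ltW gamma_gt0)//.
by rewrite divr_ge0 ?exprn_ge0 ?(ltW kap0)// fine_ge0// Zc_ge0.
Qed.

Lemma return_law_sum : series return_law @ \oo --> (1 : R).
Proof.
pose t n := fine (Zc s V zero_nng n.-1) / kap ^+ n.
have tE n : (t n)%:E = (Zc s V zero_nng n.-1 * ((kap ^+ n)^-1)%:E)%E.
  by rewrite EFinM fineK// Zc0_fin.
have lim : (\sum_(1 <= k < n) t k)%:E @[n --> \oo] --> (fine (gamma s V))%:E.
  rewrite -gamma_fin /gamma.
  rewrite (_ : (fun _ => _) = (fun n =>
      \sum_(1 <= k < n) Zc s V zero_nng k.-1 * ((kap ^+ k)^-1)%:E)%E).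
    by apply: is_cvg_nneseries => n _ _; exact: term_ge0.
  by apply/funext => n; rewrite -sumEFin; apply: eq_bigr => k _; rewrite tE.
have {}lim : \sum_(1 <= k < n) t k @[n --> \oo] --> fine (gamma s V).
  exact: (fine_cvg lim).
have -> : series return_law = (fun n => (fine (gamma s V))^-1 * \sum_(1 <= k < n) t k).
  apply/funext => -[|n]; first by rewrite /series /= !big_geq// mulr0.
  rewrite /series /= big_ltn// add0r mulr_sumr [LHS]big_nat [RHS]big_nat.
  by apply: eq_bigr => -[].
rewrite -(mulVf gamma0); apply: cvgM => //; exact: cvg_cst.
Qed.

Variable delta : {nonneg R}.

(** The decomposition at the first visit to 0, normalised by kappa and gamma. *)
Lemma Ztc_renewal N : (0 < N)%N -> Ztc s V delta N =
  delta%:num * \sum_(0 <= k < N.+1) return_law k * Ztc s V delta (N - k).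
Proof.
case: N => // N _.
have kN n : kap ^+ n != 0 by rewrite expf_neq0 ?gt_eqF.
rewrite big_nat_recl//= mul0r add0r [in LHS]fine_Zc_first_zero; last exact: Zc0_fin.
rewrite [in RHS]big_nat_recr//= subnn mulr1.
set G := fine (gamma s V).
have G0 : G != 0 by [].
rewrite mulrDr mulrDl addrC [in RHS]mulrDr; congr (_ + _); first by rewrite /qlaw -/G /= !mulrA.
rewrite mulr_sumr mulr_suml mulr_sumr [LHS]big_nat [RHS]big_nat.
apply: eq_bigr => k /andP[_ kN'].
have -> : (N.+1 - k.+1 = (N - k.+1).+1)%N by lia.
rewrite /= /qlaw -/G /=.
have -> : kap ^+ N.+1 = kap ^+ k.+1 * kap ^+ (N - k.+1).+1.
  by rewrite -exprD; congr (_ ^+ _); lia.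
by field; rewrite G0 !kN.
Qed.

(** The decomposition at the last visit to 0, normalised by kappa. *)
Lemma Ztf_convolution (p : nat -> R) : (forall n, Zf s V zero_nng n = (kap ^+ n * p n)%:E) ->
  forall N, Ztf s V delta N = \sum_(0 <= k < N.+1) Ztc s V delta k * p (N - k)%N.
Proof.
move=> pE N.
have kN n : kap ^+ n != 0 by rewrite expf_neq0 ?gt_eqF.
have Zffin n : Zf s V zero_nng n \is a fin_num by rewrite pE.
rewrite /Ztf fine_Zf_last_zero//; last exact: Zc0_fin.
rewrite big_nat_recl//= subn0 mul1r mulrDl; congr (_ + _).
  by rewrite pE /= mulrAC divff// mul1r.
rewrite mulr_suml [LHS]big_nat [RHS]big_nat; apply: eq_bigr => k /andP[_ kN'].
rewrite pE /=.
have -> : kap ^+ N = kap ^+ k.+1 * kap ^+ (N - k.+1).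
  by rewrite -exprD; congr (_ ^+ _); lia.
by field; rewrite !kN gamma0.
Qed.

End assembly.

Theorem lemma3p1 (R : realType) (s : setup) (V : R -> \bar R)
    (V_ninfty : forall x, V x != -oo%E)
    (V0_fin : (V 0%R < +oo)%E)
    (kappa_fin : (kappa s V < +oo)%E)
    (V_cont : s = ContinuousSetup -> continuous (fun x : R => expeR (- V x)%E))
    (d : measure_display) (T : measurableType d) (P : probability T R)
    (Y : nat -> {RV P >-> R})
    (Y_iid : iid_gibbs s V Y)
    (Y_int : P.-integrable setT (EFin \o Y 0%N))
    (Y_centered : ('E_P[Y 0%N] = 0)%E)
    (Y_var : slowly_varying (truncated_variance (Y 0%N)))
    (L : R -> R) (L_norming : norming_function (Y 0%N) L)
    (delta : {nonneg R}) (delta_gt0 : 0 < delta%:num)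
    (delta_lt1 : delta%:num < 1)
    (c_q : R) (c_q_gt0 : 0 < c_q)
    (q_asymp : asymp_equiv \oo (qlaw s V)
       (fun n : nat => c_q * L n%:R * n%:R `^ (- (3 / 2))))
    (L' : nat -> R)
    (L'_def : forall n, L' n = Num.sqrt n%:R * positivity_prob Y n)
    (L'_sv : slowly_varying_seq L') :
  asymp_equiv \oo (Ztc s V delta)
    (fun N : nat => delta%:num * c_q / (1 - delta%:num) ^+ 2
                    * (L N%:R / N%:R `^ (3 / 2))) /\
  asymp_equiv \oo (Ztf s V delta)
    (fun N : nat => 1 / (1 - delta%:num) * (L' N / N%:R `^ (1 / 2))).
Proof.
have [Y_indep Y_gibbs] := Y_iid.
have [L_sv _] := L_norming.
have kappa_ge0 : (0 <= kappa s V)%E by apply: integral_ge0 => y _; exact: expeR_ge0.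
have kappaE : kappa s V = (fine (kappa s V))%:E by rewrite fineK// ge0_fin_numE.
have kap0 : 0 < fine (kappa s V).
  rewrite lt_neqAle fine_ge0// andbT; apply/negP => /eqP k0.
  have := Y_gibbs 0%N setT measurableT; rewrite -k0 invr0 mul0e.
  move=> /eqP; rewrite probability_setT; apply/negP; exact: oner_neq0.
(* Were gamma infinite or 0, fine gamma and with it qlaw would vanish,
   against the asymptotics of qlaw. *)
have gamma0 : fine (gamma s V) != 0.
  apply/eqP => g0; move: q_asymp; rewrite /asymp_equiv.
  have -> : (fun t => qlaw s V t / (c_q * L t%:R * t%:R `^ (- (3 / 2)))) = cst 0.
    by apply/funext => t; rewrite /qlaw g0 invr0 !mul0r.
  move=> /(cvg_unique (@Rhausdorff R) (cvg_cst 0)) => /eqP.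
  by rewrite eq_sym oner_eq0.
have qE n : (0 < n)%N -> return_law s V n = qlaw s V n by case: n.
have q_asymp' : asymp_equiv \oo (return_law s V) (fun n : nat => c_q * L n%:R * n%:R `^ (- (3 / 2))).
  apply: cvg_trans q_asymp; apply: near_eq_cvg; near=> n.
  by rewrite qE//; near: n; exact: nbhs_infty_gt.
have renew N : (0 < N)%N -> Ztc s V delta N =
  delta%:num * \sum_(0 <= k < N.+1) return_law s V k * Ztc s V delta (N - k).
  exact: Ztc_renewal.
have q_sum : series (return_law s V) @ \oo --> (1 : R) by exact: return_law_sum.
have q_ge0 n : 0 <= return_law s V n by exact: return_law_ge0.
have Y_law i (A : set (measurableTypeR R)) : measurable A ->
    P (Y i @^-1` A) = ((fine (kappa s V))^-1%:E * \int[sf_refmeas s]_(x in A) weight s V x)%E.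
  by move=> mA; rewrite -refmeas_integral_weight; exact: Y_gibbs.
have w_fin x : weight s V x \is a fin_num.
  rewrite /weight patchE; case: ifP => // _; exact: expeRN_fin.
have w_lat x : ~ lattice s x -> weight s V x = 0%E.
  by move=> sx; rewrite /weight patchE memNset.
have pE n : Zf s V zero_nng n = (fine (kappa s V) ^+ n * positivity_prob Y n)%:E.
  rewrite Zf_iter//= pinned_step0.
  exact: (positive_walk_prob Y_indep (measurable_weight V_ninfty V_cont)
    (weight_ge0 s V) w_fin w_lat kap0 Y_law n).
split.
  exact: (constrained_asymp L_sv c_q_gt0 delta_gt0 delta_lt1 _ q_ge0 q_sum q_asymp' _ renew).
have p_ge0 n : 0 <= positivity_prob Y n by rewrite fine_ge0.
have := free_asymp L_sv c_q_gt0 delta_gt0 delta_lt1 (erefl : return_law s V 0%N = 0)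
  q_ge0 q_sum q_asymp' (erefl : Ztc s V delta 0%N = 1) renew p_ge0 L'_def L'_sv.
by rewrite (funext (Ztf_convolution V_ninfty V_cont kap0 gamma0 delta pE)).
Unshelve. all: by end_near. Qed.
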